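(* For each positive integer $n$ let $Q=(Q_{ij})_{1\le i,j\le n}$ be a random real symmetric $n\times n$ matrix such that: (A1) the diagonal entries $(Q_{ii})_{i=1}^n$ and the upper-triangular off-diagonal entries $(Q_{ij})_{1\le i<j\le n}$ are mutually independent; (A2) the diagonal entries are i.i.d. with distribution function $F_D$, the off-diagonal entries are i.i.d. with distribution function $F_O$, and both laws are absolutely continuous with respect to Lebesgue measure; (A3) with $m_n:=\min_{1\le i\le n}Q_{ii}$, one has $n^5\,\mathbb{E}[F_O(m_n)^4]\to 0$. Then $$\mathbb{P}\bigl(\text{the optimizer of the DNN problem }\vartheta(Q)\text{ is unique and rank one}\bigr)\to 1.$$ More precisely, let $M:=Q-m_nE$, and let $\mathcal{C}(G_n^-)$ be the set of connected components of the defect graph $G_n^-$. Then $$\lim_{n\to\infty}\mathbb{P}\Bigl(\max_{C\in\mathcal{C}(G_n^-)}|C|\le 4\Bigr)=1.$$ On the event $\{\max_{C\in\mathcal{C}(G_n^-)}|C|\le 4\}$, the global shifted DNN value satisfies $\vartheta(M)=\min_{C\in\mathcal{C}(G_n^-)}\vartheta(M[C])$. Since the doubly nonnegative and completely positive cones of $r\times r$ matrices coincide for $r\le4$, each local relaxation is exact, i.e. $\vartheta(M[C])=\mu(M[C])$ for every $C\in\mathcal{C}(G_n^-)$; and absolute continuity implies that almost surely all local candidate values are distinct; hence the optimizer of the global DNN problem is unique and rank one.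
   Context: $E$ is the all-ones matrix and $\mathbf 1$ the all-ones vector of appropriate dimension, and $\langle A,B\rangle=\operatorname{tr}(A^\top B)$. For a symmetric $Z\in\mathbb{R}^{r\times r}$, the DNN (doubly nonnegative) problem is $$\vartheta(Z):=\min\{\langle Z,Y\rangle:\ \langle E,Y\rangle=1,\ Y\succeq0,\ Y\ge0\},$$ over symmetric $Y\in\mathbb{R}^{r\times r}$, where $Y\succeq 0$ means positive semidefinite and $Y\ge0$ means entrywise nonnegative. Also $\mu(Z):=\min\{x^\top Zx:\ x\in\Delta^{r-1}\}$, where $\Delta^{r-1}:=\{x\in\mathbb{R}^r: x\ge 0,\ \mathbf{1}^\top x=1\}$. A matrix is doubly nonnegative if it is positive semidefinite and entrywise nonnegative, and completely positive if it is a finite sum of matrices $yy^\top$ with $y$ entrywise nonnegative. For $C\subseteq[n]=\{1,\dots,n\}$, $Q[C]$ and $M[C]$ are the principal submatrices indexed by $C$. The defect graph $G_n^-$ is the graph on vertex set $[n]$ whose edges are the pairs $\{i,j\}$, $i<j$, with $M_{ij}<0$, equivalently $Q_{ij}<m_n$. Local candidate values: for a component $C$ with $|C|\le4$ and a nonempty support $T\subseteq C$, the candidate value $\lambda_T$ is defined as follows. If $T=\{i\}$, then $T$ is admissible and $\lambda_T:=Q_{ii}$. If $|T|\ge2$, then $T$ is called admissible if the KKT system $Q[T]x=\lambda\mathbf 1$, $\mathbf 1^\top x=1$ has an invertible coefficient matrix $\begin{pmatrix}Q[T]&-\mathbf 1\\ \mathbf 1^\top&0\end{pmatrix}$, its unique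 solution $(x_T,\lambda_T)$ has all entries of $x_T$ strictly positive, and $u^\top Q[T]u>0$ for every nonzero $u\in\mathbb{R}^{|T|}$ with $\mathbf 1^\top u=0$. The local candidate values are the numbers $\lambda_T$ for admissible $T\subseteq C$, $C\in\mathcal{C}(G_n^-)$ (replacing $Q$ by $M$ shifts all of them by the same constant $-m_n$). *)

(* Defs.v *)
From HB Require Import structures.
From mathcomp Require Import all_boot all_order all_algebra.
From mathcomp Require Import all_classical all_reals all_analysis.

Set Implicit Arguments.
Unset Strict Implicit.
Unset Printing Implicit Defensive.

Import Order.TTheory GRing.Theory Num.Theory.
Import numFieldNormedType.Exports.

Local Open Scope classical_set_scope.
Local Open Scope ring_scope.

Section QuadraticPrograms.
Variable R : realType.

Definition ones (m n : nat) : 'M[R]_(m, n) := const_mx 1.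

Definition frob (r : nat) (A B : 'M[R]_r) : R := \tr (A^T *m B).

Definition quadform (r : nat) (A : 'M[R]_r) (x : 'cV[R]_r) : R :=
  (x^T *m A *m x) 0 0.

Definition vecsum (r : nat) (x : 'cV[R]_r) : R := (ones 1 r *m x) 0 0.

Definition psd (r : nat) (A : 'M[R]_r) : Prop :=
  A^T = A /\ forall x : 'cV[R]_r, 0 <= quadform A x.

Definition entrywise_nonneg (r : nat) (A : 'M[R]_r) : Prop :=
  forall i j, 0 <= A i j.

Definition doubly_nonneg (r : nat) (A : 'M[R]_r) : Prop :=
  psd A /\ entrywise_nonneg A.

Definition completely_positive (r : nat) (A : 'M[R]_r) : Prop :=
  exists (k : nat) (y : 'I_k -> 'cV[R]_r),
    (forall s i, 0 <= y s i 0) /\ A = \sum_s y s *m (y s)^T.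

Definition dnn_feasible (r : nat) (Y : 'M[R]_r) : Prop :=
  frob (ones r r) Y = 1 /\ doubly_nonneg Y.

Definition dnn_optimizer (r : nat) (Z Y : 'M[R]_r) : Prop :=
  dnn_feasible Y /\ forall Y', dnn_feasible Y' -> frob Z Y <= frob Z Y'.

Definition simplex (r : nat) : set 'cV[R]_r :=
  [set x : 'cV[R]_r | (forall i, 0 <= x i 0) /\ vecsum x = 1].
Arguments simplex : clear implicits.

(* For 0 < r the infima below are minima, see [dnn_value_attained] and
   [simplex_value_attained]. *)
Definition dnn_value (r : nat) (Z : 'M[R]_r) : R :=
  inf [set frob Z Y | Y in @dnn_feasible r].

Definition simplex_value (r : nat) (Z : 'M[R]_r) : R :=
  inf [set quadform Z x | x in simplex r].

Definition unique_rank_one_optimizer (r : nat) (Z : 'M[R]_r) : Prop :=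
  exists Y, [/\ dnn_optimizer Z Y,
                forall Y', dnn_optimizer Z Y' -> Y' = Y
              & \rank Y = 1%N].

Definition principal (n : nat) (A : 'M[R]_n) (C : {set 'I_n}) : 'M[R]_#|C| :=
  mxsub (@enum_val _ (mem C)) (@enum_val _ (mem C)) A.

Lemma frobE r (A B : 'M[R]_r) : frob A B = \sum_i \sum_j A i j * B i j.
Proof.
rewrite /frob /mxtrace exchange_big /=; apply: eq_bigr => j _.
by rewrite mxE; apply: eq_bigr => i _; rewrite mxE.
Qed.

Lemma quadformE r (A : 'M[R]_r) x :
  quadform A x = \sum_i \sum_j x i 0 * A i j * x j 0.
Proof.
rewrite /quadform mxE exchange_big /=; apply: eq_bigr => j _.
by rewrite mxE mulr_suml; apply: eq_bigr => i _; rewrite mxE.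
Qed.

Lemma vecsumE r (x : 'cV[R]_r) : vecsum x = \sum_i x i 0.
Proof. by rewrite /vecsum mxE; apply: eq_bigr => i _; rewrite mxE mul1r. Qed.

Lemma sum_continuous (T : topologicalType) (I : finType) (f : I -> T -> R) :
  (forall i, continuous (f i)) -> continuous (fun t => \sum_i f i t).
Proof.
move=> cf; apply: (@continuous_big R^o) => //.
by move=> x; exact: add_continuous.
Qed.

Lemma mul_continuous (T : topologicalType) (f g : T -> R) :
  continuous f -> continuous g -> continuous (fun t => f t * g t).
Proof. by move=> cf cg t; apply: continuousM; [exact: cf|exact: cg]. Qed.

Lemma le_closed (T : topologicalType) (f g : T -> R) :
  continuous f -> continuous g -> closed [set t | f t <= g t].
Proof.
move=> cf cg.
have -> : [set t | f t <= g t] = (fun t => g t - f t) @^-1` [set x | 0 <= x].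
  by apply/seteqP; split => t /=; rewrite subr_ge0.
apply: preimage_closed; last exact: closed_ge.
by move=> t _; apply: (@continuousB _ R^o); [exact: cg|exact: cf].
Qed.

Lemma forall_closed (T : topologicalType) (I : Type) (S : I -> set T) :
  (forall i, closed (S i)) -> closed [set t | forall i, S i t].
Proof.
move=> cS; have -> : [set t | forall i, S i t] = \bigcap_i S i.
  by apply/seteqP; split => t /= h i; [move=> _; exact: h|exact: h].
by apply: closed_bigI => i _; exact: cS.
Qed.

Lemma inf_min (T : Type) (S : set T) (f : T -> R) (t : T) :
  S t -> (forall s, S s -> f t <= f s) -> inf [set f s | s in S] = f t.
Proof.
move=> St ft; apply/eqP; rewrite eq_le; apply/andP; split.
  by apply: ge_inf; [exists (f t) => _ [s Ss <-]; exact: ft|exists t].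
by apply: lb_le_inf; [exists (f t), t|move=> _ [s Ss <-]; exact: ft].
Qed.

Lemma simplex_value_attained (r : nat) (Z : 'M[R]_r) : (0 < r)%N ->
  exists2 x, simplex r x & simplex_value Z = quadform Z x.
Proof.
case: r Z => // r Z _.
pose S := [set v : 'rV[R]_r.+1 | simplex _ v^T].
have cc i : continuous (fun v : 'rV[R]_r.+1 => v 0 i).
  exact: coord_continuous.
have vs (v : 'rV[R]_r.+1) : vecsum v^T = \sum_i v 0 i.
  by rewrite vecsumE; apply: eq_bigr => i _; rewrite mxE.
have closedS : closed S.
  have -> : S = [set v : 'rV[R]_r.+1 | forall i, 0 <= v 0 i] `&`
      [set v | \sum_i v 0 i <= 1] `&` [set v | 1 <= \sum_i v 0 i].
    apply/seteqP; split => v; rewrite /S /simplex /= vs.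
      by case=> v0 ->; do !split=> //; move=> i; have := v0 i; rewrite mxE.
    case=> -[v0 v1 v1']; split; last by apply/eqP; rewrite eq_le v1.
    by move=> i; rewrite mxE.
  apply: closedI; [apply: closedI|].
  - by apply: forall_closed => i; apply: le_closed; [exact: cst_continuous|].
  - by apply: le_closed; [exact: sum_continuous|exact: cst_continuous].
  - by apply: le_closed; [exact: cst_continuous|exact: sum_continuous].
have compactS : compact S.
  have box : compact
      [set v : 'rV[R]_r.+1 | forall i, `[0, 1]%classic (v ord0 i)].
    apply: (@rV_compact R _ (fun=> `[0, 1]%classic)) => _.
    exact: segment_compact.
  apply: (subclosed_compact closedS box).
  move=> v [v0 v1] i /=; rewrite in_itv /=.
  have {}v0 j : 0 <= v 0 j by have := v0 j; rewrite mxE.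
  by rewrite v0 -v1 vs (bigD1 i) //= lerDl sumr_ge0.
have S0 : S !=set0.
  exists (delta_mx 0 0); split.
    by move=> i; rewrite !mxE; case: eqP; case: eqP.
  rewrite vecsumE (bigD1 ord0) //= !mxE !eqxx big1 ?addr0//= => j /negbTE j0.
  by rewrite !mxE eqxx j0.
have cf : continuous (fun v : 'rV[R]_r.+1 => quadform Z v^T).
  have -> : (fun v : 'rV[R]_r.+1 => quadform Z v^T) =
      (fun v => \sum_i \sum_j v 0 i * Z i j * v 0 j).
    apply/funext => v; rewrite quadformE.
    by apply: eq_bigr => i _; apply: eq_bigr => j _; rewrite !mxE.
  apply: sum_continuous => i; apply: sum_continuous => j.
  apply: mul_continuous; last exact: cc.
  by apply: mul_continuous; [exact: cc|exact: cst_continuous].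
have [v Sv vmin] := compact_EVT_min S0 compactS (continuous_subspaceT cf).
rewrite inE in Sv; exists v^T => //; apply: inf_min => // x xS.
have := vmin x^T; rewrite trmxK; apply.
by rewrite inE /S /= trmxK.
Qed.

Lemma dnn_value_attained (r : nat) (Z : 'M[R]_r) : (0 < r)%N ->
  exists2 Y, dnn_optimizer Z Y & dnn_value Z = frob Z Y.
Proof.
case: r Z => // r Z _.
pose N := (r.+1 * r.+1)%N.
pose S := [set v : 'rV[R]_N | dnn_feasible (vec_mx v)].
have cc i j : continuous (fun v : 'rV[R]_N => vec_mx v i j).
  move=> v; have -> : (fun v : 'rV[R]_N => vec_mx v i j) =
      (fun v => v 0 (mxvec_index i j)) by apply/funext => w; rewrite mxE.
  exact: coord_continuous.
have cE (A : 'M[R]_r.+1) : continuous (fun v : 'rV[R]_N => frob A (vec_mx v)).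
  have -> : (fun v : 'rV[R]_N => frob A (vec_mx v)) =
      (fun v => \sum_i \sum_j A i j * vec_mx v i j).
    by apply/funext => v; rewrite frobE.
  apply: sum_continuous => i; apply: sum_continuous => j.
  by apply: mul_continuous; [exact: cst_continuous|exact: cc].
have cq x : continuous (fun v : 'rV[R]_N => quadform (vec_mx v) x).
  have -> : (fun v : 'rV[R]_N => quadform (vec_mx v) x) =
      (fun v => \sum_i \sum_j x i 0 * vec_mx v i j * x j 0).
    by apply/funext => v; rewrite quadformE.
  apply: sum_continuous => i; apply: sum_continuous => j.
  apply: mul_continuous; last exact: cst_continuous.
  by apply: mul_continuous; [exact: cst_continuous|exact: cc].
have closedS : closed S.
  have -> : S = [set v : 'rV[R]_N | frob (ones r.+1 r.+1) (vec_mx v) <= 1] `&`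
      [set v | 1 <= frob (ones r.+1 r.+1) (vec_mx v)] `&`
      [set v | forall ij,
        (vec_mx v : 'M[R]_r.+1) ij.1 ij.2 <= vec_mx v ij.2 ij.1]
      `&` [set v | forall x, 0 <= quadform (vec_mx v : 'M[R]_r.+1) x] `&`
      [set v | forall ij, 0 <= (vec_mx v : 'M[R]_r.+1) ij.1 ij.2].
    apply/seteqP; split => v /=.
      case=> /= -> [[vT v0] vp]; split; last by case=> i j; exact: vp.
      by do !split=> //; case=> i j /=; rewrite -[in leLHS]vT mxE.
    case=> -[[[v1 v1'] vT] v0] vp; split; first by apply/eqP; rewrite eq_le v1.
    split; [split=> //|by move=> i j; exact: (vp (i, j))].
    apply/matrixP => i j; rewrite mxE; apply/eqP; rewrite eq_le.
    by rewrite (vT (i, j)) (vT (j, i)).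
  apply: closedI; [apply: closedI; [apply: closedI; [apply: closedI|]|]|].
  - by apply: le_closed; [exact: cE|exact: cst_continuous].
  - by apply: le_closed; [exact: cst_continuous|exact: cE].
  - by apply: forall_closed => ij; apply: le_closed; exact: cc.
  - apply: forall_closed => x.
    by apply: le_closed; [exact: cst_continuous|exact: cq].
  - apply: forall_closed => ij.
    by apply: le_closed; [exact: cst_continuous|exact: cc].
have compactS : compact S.
  have box : compact [set v : 'rV[R]_N | forall i, `[0, 1]%classic (v ord0 i)].
    apply: (@rV_compact R _ (fun=> `[0, 1]%classic)) => _.
    exact: segment_compact.
  apply: (subclosed_compact closedS box).
  move=> v [v1 [_ v0]] k /=; rewrite in_itv /=.
  case/mxvec_indexP: k => i j.
  have := v0 i j; rewrite mxE => -> /=; move: v1; rewrite frobE.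
  rewrite (bigD1 i) //= (bigD1 j) //= !mxE mul1r => <-.
  rewrite -addrA lerDl addr_ge0// ?sumr_ge0// => k _.
    by rewrite mxE mul1r.
  by apply: sumr_ge0 => l _; rewrite mxE mul1r.
have S0 : S !=set0.
  exists (mxvec (delta_mx 0 0)); rewrite /S /= mxvecK; split; last split.
  - rewrite frobE (bigD1 ord0) //= (bigD1 ord0) //= !mxE !eqxx mulr1.
    rewrite big1 ?addr0 => [|j /negbTE j0]; last by rewrite !mxE j0 andbF mulr0.
    rewrite big1 ?addr0 // => i /negbTE i0; rewrite big1// => j _.
    by rewrite !mxE i0 mulr0.
  - split; first by rewrite trmx_delta.
    move=> x; rewrite quadformE (bigD1 ord0) //= (bigD1 ord0) //=.
    rewrite !mxE !eqxx mulr1 -expr2.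
    rewrite big1 ?addr0 => [|j /negbTE j0].
      rewrite big1 ?addr0 ?sqr_ge0// => i /negbTE i0; rewrite big1// => j _.
      by rewrite !mxE i0 mulr0 mul0r.
    by rewrite !mxE j0 andbF mulr0 mul0r.
  - by move=> i j; rewrite mxE; case: andP.
have [v Sv vmin] := compact_EVT_min S0 compactS (continuous_subspaceT (cE Z)).
rewrite inE in Sv.
have opt : dnn_optimizer Z (vec_mx v).
  split=> // Y Yf; have := vmin (mxvec Y); rewrite mxvecK; apply.
  by rewrite inE /S /= mxvecK.
by exists (vec_mx v) => //; apply: inf_min => //; exact: opt.2.
Qed.

End QuadraticPrograms.

Arguments ones {R} m n.
Arguments simplex {R} r.

Section DefectGraph.
Variables (R : realType) (n : nat).
Implicit Types (Q : 'M[R]_n.+1) (C T : {set 'I_n.+1}).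

Definition diag_min Q : R := \big[Num.min/Q ord0 ord0]_i Q i i.

Definition shifted Q : 'M[R]_n.+1 := Q - diag_min Q *: ones n.+1 n.+1.

(* Meant for symmetric Q, for which this relation is symmetric. *)
Definition defect_edge Q : rel 'I_n.+1 :=
  fun i j => (i != j) && (shifted Q i j < 0).

Definition component Q (i : 'I_n.+1) : {set 'I_n.+1} :=
  [set j | connect (defect_edge Q) i j]%SET.

Definition components Q : {set {set 'I_n.+1}} :=
  [set component Q i | i in 'I_n.+1]%SET.

Definition max_component_size Q : nat := \max_(C in components Q) #|C|.

(* The components form a nonempty finite family; the seed of the iterated
   minimum is the value at the component of vertex 0. *)
Definition min_component_value Q (f : {set 'I_n.+1} -> R) : R :=
  \big[Num.min/f (component Q ord0)]_(C in components Q) f C.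

Definition kkt_matrix Q T : 'M[R]_(#|T| + 1) :=
  block_mx (principal Q T) (- ones #|T| 1) (ones 1 #|T|) 0.

(* [candidate Q T l]: the support T is admissible and l is its candidate
   value; l is determined by Q and T since the KKT matrix is invertible. *)
Definition candidate Q T (l : R) : Prop :=
  (exists2 i, T = [set i]%SET & l = Q i i) \/
  [/\ (2 <= #|T|)%N,
      kkt_matrix Q T \in unitmx,
      exists x : 'cV[R]_#|T|,
        [/\ principal Q T *m x = l *: ones #|T| 1,
            vecsum x = 1
          & forall i, 0 < x i 0]
    & forall u : 'cV[R]_#|T|, u != 0 -> vecsum u = 0 ->
        0 < quadform (principal Q T) u].

(* Distinctness is between different supports, over all components with at
   most 4 vertices. *)
Definition local_candidates_distinct Q : Prop :=
  forall C1 C2 T1 T2 (l1 l2 : R),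
    C1 \in components Q -> C2 \in components Q ->
    (#|C1| <= 4)%N -> (#|C2| <= 4)%N ->
    T1 \subset C1 -> T2 \subset C2 ->
    candidate Q T1 l1 -> candidate Q T2 l2 ->
    T1 <> T2 -> l1 <> l2.

End DefectGraph.

Definition mutually_independent d (T : measurableType d) (R : realType)
    (P : probability T R) (I : finType) (X : I -> T -> R) : Prop :=
  forall (J : {set I}) (A : I -> set R),
    (forall i, i \in J -> measurable (A i)) ->
    P (\bigcap_(i in [set` J]) (X i @^-1` A i)) =
      (\prod_(i in J) P (X i @^-1` A i))%E.

Definition random_matrix d (T : measurableType d) (R : realType)
    (P : probability T R) (n : nat) (X : 'I_n -> 'I_n -> {RV P >-> R})
    (w : T) : 'M[R]_n :=
  \matrix_(i, j) X i j w.

(* Main.v *)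
(* A component of G_n^- with at least five vertices contains a tree on five
   vertices, that is four distinct off-diagonal entries below m_n; slicing by the
   value of F_O(m_n) and using independence, this has probability at most
   8 E[F_O(m_n)^4] for each of the at most 625 n^5 labelled trees.
   For r <= 4 a doubly nonnegative matrix is made singular by subtracting rank one
   nonnegative matrices. A kernel vector with at most one negative entry reduces
   the order by one; the only other sign pattern is (+,+,-,-) at order 4, where
   further subtractions kill the entries between one + and both -, hence a whole
   row, unless the kernel becomes two-dimensional and contains a vector with a zero
   entry.
   Off-component entries of M are nonnegative and theta(M) <= 0, so every block of
   an optimizer is optimal for its component and is a sum of y y' with y
   proportional to a minimizer of the quadratic form on the simplex. Moving a
   degenerate minimizer both ways along a flat direction shrinks its support, so
   distinct candidate values leave only one minimizer.
   Distinctness holds almost surely because for i in T the equation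
   det (Q[T] - l E) = 0 is affine in Q_ii with nonzero slope, so a coincidence with
   a candidate value not involving Q_ii determines Q_ii from the other entries. *)

Require Import Defs.
From HB Require Import structures.
From mathcomp Require Import all_boot all_order all_algebra.
From mathcomp Require Import all_classical all_reals all_analysis.
From mathcomp Require Import ring lra measurable_realfun.

Set Implicit Arguments.
Unset Strict Implicit.
Unset Printing Implicit Defensive.

Import Order.TTheory GRing.Theory Num.Theory.
Import numFieldNormedType.Exports.

Local Open Scope classical_set_scope.
Local Open Scope ring_scope.

(** * Doubly nonnegative matrices of order at most four *)

(** The first limit compares probabilities, so the event of a unique rank one optimizer must be
    measurable, although it quantifies over all optimizers. It is rewritten as: every optimizer has
    vanishing principal minors of order two. By compactness this says that, for each k, a rational
    number separates the optimal value from the values on feasible matrices whose minor defect is at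
    least 1/(k+1); the events involved are countable unions of boxes around rational matrices.

    In the tree bound the four edge events share the random threshold m_n, hence are dependent. On a
    slice a <= F_O(m_n) < a + 1/N they imply F_O(Q_ij) < a + 1/N, events independent of the slice;
    (a + 1/N)^4 <= 8 (a^4 + N^-4) yields the 8, and N is arbitrary. The factor 625 = 5^4 counts all
    maps from four edges to a parent among five vertices.

    In the coincidence argument nothing is conditioned upon: Q_ii and a function of the other
    entries have a product joint law, and Q_ii has no atoms. *)

Section BilinearForm.
Variable R : realType.

Definition bil r (A : 'M[R]_r) (x y : 'cV[R]_r) : R := (x^T *m A *m y) 0 0.

Lemma quadform_bil r (A : 'M[R]_r) x : quadform A x = bil A x x.
Proof. by []. Qed.

Lemma bilDl r (A : 'M[R]_r) x y z : bil A (x + y) z = bil A x z + bil A y z.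
Proof. by rewrite /bil linearD /= !mulmxDl mxE. Qed.

Lemma bilDr r (A : 'M[R]_r) x y z : bil A z (x + y) = bil A z x + bil A z y.
Proof. by rewrite /bil mulmxDr mxE. Qed.

Lemma bilZl r (A : 'M[R]_r) a x z : bil A (a *: x) z = a * bil A x z.
Proof. by rewrite /bil linearZ /= -!scalemxAl mxE. Qed.

Lemma bilZr r (A : 'M[R]_r) a x z : bil A z (a *: x) = a * bil A z x.
Proof. by rewrite /bil -!scalemxAr mxE. Qed.

Lemma bilC r (A : 'M[R]_r) x y : A^T = A -> bil A x y = bil A y x.
Proof.
move=> sA; rewrite /bil.
have -> : y^T *m A *m x = (x^T *m A *m y)^T.
  by rewrite !trmx_mul trmxK sA mulmxA.
by rewrite [RHS]mxE.
Qed.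

Lemma bilE r (A : 'M[R]_r) x y : bil A x y = \sum_i x i 0 * (A *m y) i 0.
Proof. by rewrite /bil -mulmxA mxE; apply: eq_bigr => i _; rewrite mxE. Qed.

Lemma quadformD r (A : 'M[R]_r) x y : A^T = A ->
  quadform A (x + y) = quadform A x + 2 * bil A y x + quadform A y.
Proof.
move=> sA; rewrite !quadform_bil bilDl !bilDr (bilC x y sA); ring.
Qed.

Lemma quadformZ r (A : 'M[R]_r) a x : quadform A (a *: x) = a ^+ 2 * quadform A x.
Proof. by rewrite !quadform_bil bilZl bilZr mulrA. Qed.

Lemma quadform_delta r (A : 'M[R]_r) i : quadform A (delta_mx i 0) = A i i.
Proof. by rewrite /quadform trmx_delta -rowE -colE !mxE. Qed.

Lemma quadform_congr m n (L : 'M[R]_(m, n)) (A : 'M[R]_m) x :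
  quadform (L^T *m A *m L) x = quadform A (L *m x).
Proof. by rewrite /quadform trmx_mul !mulmxA. Qed.

Lemma quadform_rank1 r (x y : 'cV[R]_r) :
  quadform (y *m y^T) x = (y^T *m x) 0 0 ^+ 2.
Proof.
rewrite /quadform mulmxA -mulmxA mxE big_ord1 expr2; congr (_ * _).
by rewrite -[y^T *m x]trmxK trmx_mul trmxK [RHS]mxE.
Qed.

Lemma psd_congr m n (L : 'M[R]_(m, n)) (A : 'M[R]_m) :
  psd A -> psd (L^T *m A *m L).
Proof.
move=> [sA pA]; split; first by rewrite !trmx_mul trmxK sA mulmxA.
by move=> x; rewrite quadform_congr.
Qed.

Lemma psd_diag_ge0 r (A : 'M[R]_r) i : psd A -> 0 <= A i i.
Proof. by move=> [_ pA]; rewrite -quadform_delta. Qed.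

Lemma mulmx_tr_eq0 n (y : 'cV[R]_n) : (y^T *m y) 0 0 = 0 -> y = 0.
Proof.
rewrite mxE => /eqP; rewrite psumr_eq0 => [/allP y0|i _]; last first.
  by rewrite mxE -expr2 sqr_ge0.
apply/matrixP => i j; rewrite ord1 mxE.
have := y0 i (mem_index_enum i).
by rewrite mxE -expr2 sqrf_eq0 => /eqP.
Qed.

Lemma psd_bil_eq0 r (A : 'M[R]_r) x v :
  psd A -> quadform A v = 0 -> bil A x v = 0.
Proof.
move=> [sA pA] v0; apply/eqP/negPn/negP => b0.
have a0 := pA x.
set b := bil A x v in b0; set a := quadform A x in a0.
(* The form at this point would be negative. The denominator [a + 1] stays positive even if
   [quadform A x] vanishes. *)
have := pA (v + (- b / (a + 1)) *: x).
rewrite quadformD// v0 bilZl quadformZ -/a -/b add0r.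
have -> : 2 * (- b / (a + 1) * b) + (- b / (a + 1)) ^+ 2 * a =
          - (b ^+ 2 * (a + 2) / (a + 1) ^+ 2).
  by field; apply: lt0r_neq0; lra.
rewrite oppr_ge0 leNgt => /negP; apply.
apply: divr_gt0; last by apply: exprn_gt0; lra.
by apply: mulr_gt0; [rewrite exprn_even_gt0|lra].
Qed.

Lemma psd_ker r (A : 'M[R]_r) v : psd A -> quadform A v = 0 -> A *m v = 0.
Proof.
move=> pA v0; apply: mulmx_tr_eq0.
have := psd_bil_eq0 (A *m v) pA v0.
by rewrite /bil -mulmxA.
Qed.

Lemma psd_diag0 r (A : 'M[R]_r) i j : psd A -> A i i = 0 -> A i j = 0.
Proof.
move=> pA; rewrite -quadform_delta => /(psd_ker pA) /matrixP/(_ j 0).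
by rewrite -colE !mxE -{1}pA.1 mxE.
Qed.

(* Complete the square in the direction v. *)
Lemma psd_sub_rank1 r (A : 'M[R]_r) v (t : R) : psd A -> 0 <= t ->
  t * quadform A v <= 1 -> psd (A - t *: (A *m v *m (A *m v)^T)).
Proof.
move=> [sA pA] t0 t1; split.
  by rewrite linearB linearZ /= trmx_mul trmxK sA.
move=> x.
have -> : quadform (A - t *: (A *m v *m (A *m v)^T)) x =
    quadform A x - t * bil A x v ^+ 2.
  rewrite {1}/quadform mulmxBr mulmxBl mxE; congr (_ + _).
  rewrite mxE -scalemxAr -scalemxAl mxE; congr (- (_ * _)).
  by rewrite -/(quadform _ x) quadform_rank1 trmx_mul sA (bilC x v sA).
have c0 := pA v.
have [c00|cn0] := eqVneq (quadform A v) 0.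
  by rewrite (psd_bil_eq0 x _ c00)// expr0n/= mulr0 subr0.
have cp : 0 < quadform A v by rewrite lt_neqAle eq_sym cn0.
set b := bil A x v; set c := quadform A v in t1 c0 cn0 cp *.
have := pA (x + (- b / c) *: v).
rewrite quadformD// bilZl (bilC v x sA) quadformZ -/b -/c.
have -> : quadform A x + 2 * (- b / c * b) + (- b / c) ^+ 2 * c =
    quadform A x - b ^+ 2 / c by field.
rewrite !subr_ge0; apply: le_trans.
by rewrite ler_pdivlMr// mulrAC ler_piMl// sqr_ge0.
Qed.

End BilinearForm.

Section CompletelyPositive.
Variable R : realType.

Lemma cp_dnn r (A : 'M[R]_r) : completely_positive A -> doubly_nonneg A.
Proof.
move=> [k [y [y0 ->]]]; split; last first.
  move=> i j; rewrite summxE sumr_ge0// => s _.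
  by rewrite mxE big_ord1 mxE mulr_ge0.
split; first by rewrite linear_sum; apply: eq_bigr => s _; rewrite /= trmx_mul trmxK.
move=> x; rewrite /quadform mulmx_sumr mulmx_suml summxE sumr_ge0// => s _.
by rewrite -/(quadform _ x) quadform_rank1 sqr_ge0.
Qed.

Lemma cp0 r : completely_positive (0 : 'M[R]_r).
Proof. by exists 0%N, (fun=> 0); split=> [[]//|]; rewrite big_ord0. Qed.

Lemma cpD_rank1 r (A : 'M[R]_r) (t : R) (y : 'cV[R]_r) : 0 <= t -> (forall i, 0 <= y i 0) ->
  completely_positive A -> completely_positive (A + t *: (y *m y^T)).
Proof.
move=> t0 y0 [k [z [z0 ->]]].
exists k.+1, (fun s => if unlift ord_max s is Some s' then z s'
                       else Num.sqrt t *: y); split.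
  move=> s i; case: unlift => [s'|]; first exact: z0.
  by rewrite mxE mulr_ge0// sqrtr_ge0.
rewrite big_ord_recr /= unlift_none; congr (_ + _).
  apply: eq_bigr => s _.
  have -> : widen_ord (leqnSn k) s = lift ord_max s.
    by apply: val_inj; rewrite /= /bump leqNgt ltn_ord.
  by rewrite liftK.
by rewrite linearZ /= -scalemxAl -scalemxAr scalerA -expr2 sqr_sqrtr.
Qed.

Lemma cp_congr m n (L : 'M[R]_(m, n)) (B : 'M[R]_n) :
  (forall i j, 0 <= L i j) -> completely_positive B ->
  completely_positive (L *m B *m L^T).
Proof.
move=> L0 [k [y [y0 ->]]]; exists k, (fun s => L *m y s); split.
  by move=> s i; rewrite mxE sumr_ge0// => j _; rewrite mulr_ge0.
rewrite mulmx_sumr mulmx_suml; apply: eq_bigr => s _.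
by rewrite trmx_mul !mulmxA.
Qed.

(* A = L B L' with L nonnegative and B the principal submatrix without index i. *)
Lemma cp_row_comb n (A : 'M[R]_n.+1) i (c : 'I_n -> R) : A^T = A ->
  (forall k, 0 <= c k) ->
  (forall j, A i j = \sum_k c k * A (lift i k) j) ->
  completely_positive (row' i (col' i A)) -> completely_positive A.
Proof.
move=> sA c0 rowi.
pose L : 'M[R]_(n.+1, n) := \matrix_(a, k)
  if unlift i a is Some a' then (a' == k)%:R else c k.
have LA m (B : 'M[R]_(n.+1, m)) :
    (forall j, B i j = \sum_k c k * B (lift i k) j) -> L *m row' i B = B.
  move=> Bi; apply/matrixP => a j; rewrite mxE.
  case: (unliftP i a) => [a' ->|->].
    rewrite (bigD1 a')//= big1 ?addr0 ?mxE ?liftK ?eqxx ?mul1r ?mxE// => k ka.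
    by rewrite mxE liftK eq_sym (negbTE ka) mul0r.
  by rewrite Bi; apply: eq_bigr => k _; rewrite !mxE unlift_none.
have -> : row' i (col' i A) = row' i (row' i A)^T.
  by rewrite -[in LHS]sA; apply/matrixP => a b; rewrite !mxE.
have L0 a k : 0 <= L a k by rewrite mxE; case: unlift => // a'; exact: ler0n.
move=> /(cp_congr L0).
rewrite LA; last first.
  have tA a b : A a b = A b a by rewrite -{1}sA mxE.
  by move=> j; rewrite !mxE tA rowi; apply: eq_bigr => k _; rewrite !mxE tA.
by rewrite -trmx_mul LA// sA.
Qed.

Lemma dnn_row' n (A : 'M[R]_n.+1) i :
  doubly_nonneg A -> doubly_nonneg (row' i (col' i A)).
Proof.
move=> [[sA pA] A0]; split; last by move=> a b; rewrite !mxE.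
have -> : row' i (col' i A) =
    (rowsub (lift i) 1%:M)^T^T *m A *m (rowsub (lift i) 1%:M)^T.
  rewrite trmxK -rowsubE -[RHS]trmxK trmx_mul trmxK -rowsubE.
  by apply/matrixP => a b; rewrite !mxE.
exact: psd_congr.
Qed.

(* Solving A u = 0 for the row of the negative entry expresses it as a
   nonnegative combination of the others; without a negative entry some row of A
   vanishes. *)
Lemma cp_ker_one_neg n (A : 'M[R]_n.+1) (u : 'cV[R]_n.+1) i :
  doubly_nonneg A -> A *m u = 0 -> u != 0 ->
  (forall j, j != i -> 0 <= u j 0) ->
  (forall k, completely_positive (row' k (col' k A))) ->
  completely_positive A.
Proof.
move=> [pA A0] Au u0 ui IH.
have Auk k : \sum_j A k j * u j 0 = 0 by have /matrixP/(_ k 0) := Au; rewrite !mxE.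
have [uin|uip] := ltP (u i 0) 0.
  apply: (@cp_row_comb _ A i (fun k => u (lift i k) 0 / - u i 0)) => //.
  - exact: pA.1.
  - by move=> k; rewrite divr_ge0 ?ui ?neq_lift// ?oppr_ge0 ?ltW// eq_sym neq_lift.
  move=> j; have := Auk j; rewrite (bigD1_ord i)//= => /eqP.
  rewrite addr_eq0 => /eqP Aj.
  have -> : A i j = (A j i * u i 0) / u i 0.
    by rewrite mulfK ?lt_eqF// -{1}pA.1 mxE.
  rewrite Aj mulNr -mulrN mulr_suml; apply: eq_bigr => k _.
  rewrite -{1}pA.1 mxE; field; rewrite lt_eqF//.
have {uip} u_ge0 j : 0 <= u j 0 by case: (eqVneq j i) => [->//|]; exact: ui.
have [k uk] : exists k, u k 0 != 0.
  apply/existsP; apply: contraNT u0; rewrite negb_exists => /forallP u0.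
  by apply/eqP/matrixP => k j; rewrite ord1 mxE; apply/eqP; rewrite -[_ == _]negbK.
have Akk : A k k = 0.
  have /eqP := Auk k; rewrite psumr_eq0 => [/allP/(_ k (mem_index_enum k))|j _].
    by rewrite mulf_eq0 (negbTE uk) orbF => /eqP.
  by rewrite mulr_ge0.
apply: (@cp_row_comb _ A k (fun=> 0)) => //; first exact: pA.1.
by move=> j; rewrite (psd_diag0 _ pA Akk) big1// => l _; rewrite mul0r.
Qed.

End CompletelyPositive.

Section SmallDoublyNonnegative.
Variable R : realType.

Lemma uniq_size_ord n (s : seq 'I_n) : uniq s -> (size s <= n)%N.
Proof. by move=> /card_uniqP <-; rewrite -[n in (_ <= n)%N]card_ord max_card. Qed.

Lemma at_most_one_neg n (u : 'cV[R]_n.+1) :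
  (exists i, forall j, j != i -> 0 <= u j 0) \/
  exists k l, [/\ k != l, u k 0 < 0 & u l 0 < 0].
Proof.
case: (pickP (fun k => u k 0 < 0)) => [k uk|u0]; last first.
  by left; exists ord0 => j _; rewrite leNgt u0.
case: (pickP (fun l => (l != k) && (u l 0 < 0))) => [l /andP[lk ul]|ul].
  by right; exists l, k.
by left; exists k => j jk; have := ul j; rewrite jk /= leNgt => ->.
Qed.

(** [- u] is a kernel vector as well, so the reduction by one order fails only if both signs occur
    at least twice. *)
Lemma cp_ker_sign n (A : 'M[R]_n.+1) (u : 'cV[R]_n.+1) :
  doubly_nonneg A -> A *m u = 0 -> u != 0 ->
  (forall k, completely_positive (row' k (col' k A))) ->
  completely_positive A \/
  exists i j k l, [/\ i != j, k != l, 0 < u i 0 /\ 0 < u j 0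
                    & u k 0 < 0 /\ u l 0 < 0].
Proof.
move=> dA Au u0 IH.
have [[i ui]|[k [l [kl uk ul]]]] := at_most_one_neg u.
  by left; exact: cp_ker_one_neg ui IH.
have [[i ui]|[i [j [ij ui uj]]]] := at_most_one_neg (- u).
  left; apply: (cp_ker_one_neg (u := - u) dA _ _ ui IH).
    by rewrite mulmxN Au oppr0.
  by rewrite oppr_eq0.
right; exists i, j, k, l; split => //.
by move: ui uj; rewrite !mxE !oppr_lt0.
Qed.

(** The extreme multiple allowed by [psd_sub_rank1] puts [v] into the kernel. *)
Lemma sub_rank1_ker r (A : 'M[R]_r) v : A^T = A -> quadform A v != 0 ->
  (A - (quadform A v)^-1 *: (A *m v *m (A *m v)^T)) *m v = 0.
Proof.
move=> sA c0; rewrite mulmxBl -scalemxAl -(mulmxA (A *m v)) trmx_mul sA.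
have -> : v^T *m A *m v = (quadform A v)%:M.
  by apply/matrixP => i j; rewrite !ord1 [RHS]mxE eqxx.
by rewrite mul_mx_scalar scalerA mulVf// scale1r subrr.
Qed.

Lemma dnn_cp_of_singular n :
  (forall (A : 'M[R]_n.+1) (u : 'cV[R]_n.+1), doubly_nonneg A -> A *m u = 0 -> u != 0 ->
     completely_positive A) ->
  forall A : 'M[R]_n.+1, doubly_nonneg A -> completely_positive A.
Proof.
move=> IH A dA; have [pA A0] := dA.
have [uA|] := boolP (A \in unitmx); last first.
  rewrite -unitmx_tr -row_free_unit -kermx_eq0 => /rowV0Pn[v /sub_kermxP vA v0].
  apply: (IH A v^T) => //; last by rewrite trmx_eq0.
  by apply: trmx_inj; rewrite trmx_mul trmxK vA trmx0.
(* As [A *m v] is a unit vector, the subtracted rank one matrix only touches the entry (0,0): the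
   off-diagonal entries stay nonnegative, and the diagonal does so by semidefiniteness. *)
pose e : 'cV[R]_n.+1 := delta_mx 0 0; pose v := invmx A *m e.
have Av : A *m v = e by rewrite /v mulKVmx.
have v0 : v != 0.
  apply: contra_neq (oner_neq0 R) => v0; have := congr1 (fun M : 'cV_ _ => M 0 0) Av.
  by rewrite v0 mulmx0 !mxE.
have c0 : quadform A v != 0.
  apply: contra_neq v0 => /(psd_ker pA) Av0.
  by rewrite -[v](mulKmx uA) Av0 mulmx0.
have cge0 : 0 <= (quadform A v)^-1 by rewrite invr_ge0; exact: pA.2.
have t1 : (quadform A v)^-1 * quadform A v <= 1 by rewrite mulVf.
have pA' := psd_sub_rank1 pA cge0 t1.
have := sub_rank1_ker pA.1 c0; move: pA'; rewrite Av; set A' := A - _ => pA' A'v.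
have -> : A = A' + (quadform A v)^-1 *: (e *m e^T) by rewrite subrK.
apply: cpD_rank1 => // [i|]; first by rewrite mxE ler0n.
apply: IH A'v v0; split=> // i j.
have [<-|ij] := eqVneq i j; first exact: psd_diag_ge0.
rewrite !mxE big_ord1 !mxE !eqxx !andbT.
case: eqP => [i0|_]; last by rewrite mul0r mulr0 subr0.
case: eqP => [j0|_]; last by rewrite !mulr0 subr0.
by move: ij; rewrite i0 j0 eqxx.
Qed.

(** The exceptional sign pattern takes four distinct indices, which do not fit. *)
Lemma dnn_cp_le3 n (A : 'M[R]_n) : (n <= 3)%N ->
  doubly_nonneg A -> completely_positive A.
Proof.
elim: n A => [A _ _|n IH A n3].
  by rewrite (_ : A = 0); [exact: cp0|apply/matrixP => -[]].
apply: dnn_cp_of_singular A => A u dA Au u0.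
have [//|[i [j [k [l [ij kl [ui uj] [uk ul]]]]]]] :=
  cp_ker_sign dA Au u0 (fun k => IH _ (ltnW n3) (dnn_row' k dA)).
suff : uniq [:: i; j; k; l] by move/uniq_size_ord; rewrite leqNgt ltnS n3.
rewrite /= !inE !negb_or ij kl /= !andbT.
by do !(apply/andP; split); apply/eqP => E; move: ui uj uk ul; rewrite ?E; lra.
Qed.

Let IH3 (A : 'M[R]_4) k : doubly_nonneg A -> completely_positive (row' k (col' k A)).
Proof. by move=> dA; exact/dnn_cp_le3/dnn_row'. Qed.

(** Two independent kernel vectors combine to a nonzero one with a zero entry; the exceptional sign
    pattern would then need five indices. *)
Lemma dnn4_cp_ker2 (A : 'M[R]_4) (u w : 'cV[R]_4) : doubly_nonneg A ->
  A *m u = 0 -> A *m w = 0 -> u != 0 -> (forall a, w <> a *: u) ->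
  completely_positive A.
Proof.
move=> dA Au Aw u0 wu.
have [i0 ui0] : exists i, u i 0 != 0.
  apply/existsP; apply: contraNT u0; rewrite negb_exists => /forallP u0.
  by apply/eqP/matrixP => k j; rewrite ord1 mxE; apply/eqP; rewrite -[_ == _]negbK.
pose v := w - (w i0 0 / u i0 0) *: u.
have vi0 : v i0 0 = 0 by rewrite !mxE mulfVK// subrr.
have v0 : v != 0 by apply/eqP => /eqP; rewrite subr_eq0 => /eqP /wu.
have Av : A *m v = 0 by rewrite mulmxBr Aw -scalemxAr Au scaler0 subr0.
have [//|[i [j [k [l [ij kl [ui uj] [uk ul]]]]]]] :=
  cp_ker_sign dA Av v0 (fun k => IH3 k dA).
suff : uniq [:: i0; i; j; k; l] by move/uniq_size_ord.
rewrite /= !inE !negb_or ij kl /= !andbT.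
by do !(apply/andP; split); apply/eqP => E; move: vi0 ui uj uk ul; rewrite ?E; lra.
Qed.

(* Subtracting a multiple of the rank one matrix supported on {i,k} and
   orthogonal to the kernel vector u either annihilates the entry (i,k) or
   enlarges the kernel. *)
Lemma dnn4_kill_entry (A : 'M[R]_4) (u : 'cV[R]_4) i k : doubly_nonneg A ->
  A *m u = 0 -> 0 < u i 0 -> u k 0 < 0 ->
  completely_positive A \/
  exists A' : 'M[R]_4,
    [/\ doubly_nonneg A', A' *m u = 0, A' i k = 0,
        completely_positive A' -> completely_positive A &
        forall a b, b != i -> b != k -> A' a b = A a b].
Proof.
move=> dA Au ui uk; have [pA A0] := dA.
have u0 : u != 0 by apply/eqP => u0; move: ui; rewrite u0 mxE ltxx.
have ik : i != k by apply/eqP => E; move: ui uk; rewrite E; lra.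
have [keru|] := pselect (forall w : 'cV[R]_4, A *m w = 0 -> exists a, w = a *: u);
  last first.
  move=> /existsNP[w /not_implyP[Aw /forallNP wu]].
  by left; exact: (dnn4_cp_ker2 dA Au Aw u0).
pose y : 'cV[R]_4 := (- u k 0) *: delta_mx i 0 + u i 0 *: delta_mx k 0.
have yu : y^T *m u = 0.
  rewrite /y linearD !linearZ /= !trmx_delta mulmxDl -!scalemxAl -!rowE.
  by apply/matrixP => a b; rewrite !ord1 !mxE; ring.
have ye a : y a 0 = - u k 0 * (a == i)%:R + u i 0 * (a == k)%:R.
  by rewrite !mxE !eqxx !andbT.
have yi : y i 0 = - u k 0 by rewrite ye eqxx (negbTE ik) mulr0 addr0 mulr1.
have yk : y k 0 = u i 0 by rewrite ye eqxx eq_sym (negbTE ik) mulr0 add0r mulr1.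
have y0 a : 0 <= y a 0 by rewrite ye addr_ge0 ?mulr_ge0 ?oppr_ge0 ?ler0n// ltW.
(* The range of the symmetric [A] is the orthogonal complement of its kernel, which is spanned by
   [u]. In terms of [cokermx]: its columns are killed by [A], hence are multiples of [u]. *)
have [v Av] : exists v, A *m v = y.
  suff /submxP[D yD] : (y^T <= A)%MS.
    by exists D^T; apply: trmx_inj; rewrite trmx_mul trmxK pA.1.
  rewrite submxE; apply/eqP/matrixP => a b; rewrite ord1 [RHS]mxE.
  have [|c Ec] := keru (col b (cokermx A)).
    by rewrite colE mulmxA mulmx_coker mul0mx.
  have -> : (y^T *m cokermx A) 0 b = (y^T *m col b (cokermx A)) 0 0.
    by rewrite !mxE; apply: eq_bigr => m _; rewrite !mxE.
  by rewrite Ec -scalemxAr yu scaler0 mxE.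
have Av0 : A *m v != 0.
  by rewrite Av; apply/eqP => /matrixP/(_ k 0); rewrite yk mxE => E; move: ui; lra.
have c0 : quadform A v != 0 by apply: contra_neq Av0 => /(psd_ker pA).
have cp : 0 < quadform A v by rewrite lt_neqAle eq_sym c0 pA.2.
have yyp : 0 < y i 0 * y k 0 by rewrite yi yk mulr_gt0 ?oppr_gt0.
pose A_ t := A - t *: (y *m y^T).
have A_E t a b : A_ t a b = A a b - t * (y a 0 * y b 0).
  by rewrite !mxE big_ord1 !mxE.
have A_cp t : 0 <= t -> completely_positive (A_ t) -> completely_positive A.
  by move=> t0 /(cpD_rank1 t0 y0); rewrite subrK.
have A_u t : A_ t *m u = 0.
  by rewrite mulmxBl Au -scalemxAl -mulmxA yu mulmx0 scaler0 subr0.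
have A_other t a b : b != i -> b != k -> A_ t a b = A a b.
  by move=> bi bk; rewrite A_E (ye b) (negbTE bi) (negbTE bk) !mulr0 addr0 !mulr0 subr0.
have A_dnn t : 0 <= t -> t <= (quadform A v)^-1 -> t <= A i k / (y i 0 * y k 0) ->
    doubly_nonneg (A_ t).
  move=> t0 t1 t2.
  have pA_ : psd (A_ t).
    by rewrite /A_ -Av; apply: psd_sub_rank1 => //; rewrite -ler_pdivlMr ?div1r.
  split=> // a b.
  have [<-|ab] := eqVneq a b; first exact: psd_diag_ge0.
  have sA a' b' : A_ t a' b' = A_ t b' a' by rewrite -{1}pA_.1 mxE.
  have ik0 : 0 <= A_ t i k by rewrite A_E subr_ge0 -ler_pdivlMr.
  have [bi|bi] := eqVneq b i.
    have [ak|ak] := eqVneq a k; first by rewrite ak bi sA.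
    by rewrite sA A_other// -bi.
  have [bk|bk] := eqVneq b k; last by rewrite A_other.
  have [ai|ai] := eqVneq a i; first by rewrite ai bk.
  by rewrite sA A_other// -bk.
(* Two thresholds compete: the largest multiple that preserves semidefiniteness, and the one at
   which the entry (i,k) vanishes. If the first is not larger, [v] joins the kernel, and it is no
   multiple of [u] because [A *m v] is nonzero. *)
have [t1|t1] := leP (quadform A v)^-1 (A i k / (y i 0 * y k 0)).
  left; apply: (A_cp (quadform A v)^-1); first by rewrite invr_ge0 ltW.
  apply: (dnn4_cp_ker2 (u := u) (w := v)) => //.
  - by apply: A_dnn => //; rewrite invr_ge0 ltW.
  - by rewrite /A_ -Av sub_rank1_ker// pA.1.
  - by move=> a va; move/eqP: Av0; apply; rewrite va -scalemxAr Au scaler0.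
right; exists (A_ (A i k / (y i 0 * y k 0))).
have t0 : 0 <= A i k / (y i 0 * y k 0) by rewrite divr_ge0// ltW.
split => //.
- by apply: A_dnn => //; exact: ltW.
- by rewrite A_E divfK ?subrr// lt0r_neq0.
- exact: A_cp.
- by move=> a b; exact: A_other.
Qed.

Lemma dnn_cp4 (A : 'M[R]_4) : doubly_nonneg A -> completely_positive A.
Proof.
apply: dnn_cp_of_singular A => A u dA Au u0.
have [//|[i [j [k [l [ij kl [ui uj] [uk ul]]]]]]] :=
  cp_ker_sign dA Au u0 (fun k => IH3 k dA).
have [//|[A1 [dA1 A1u A1ik cpA1 _]]] := dnn4_kill_entry dA Au ui uk.
apply: cpA1.
have [//|[A2 [dA2 A2u A2il cpA2 A2A1]]] := dnn4_kill_entry dA1 A1u ui ul.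
apply: cpA2.
have [ki li] : k != i /\ k != l.
  by split=> //; apply/eqP => E; move: ui uk; rewrite E; lra.
have A2ik : A2 i k = 0 by rewrite A2A1.
(* Row [i] vanishes at [k] and [l], and a third negative entry of [u] would give five indices. So
   all terms of row [i] of [A2 *m u] are nonnegative and sum to zero, while [u i 0] is positive. *)
have A2ii : A2 i i = 0.
  have /matrixP/(_ i 0)/eqP := A2u; rewrite !mxE psumr_eq0 => [/allP|m _].
    move=> /(_ i (mem_index_enum i)); rewrite mulf_eq0 => /orP[/eqP//|/eqP E].
    by move: ui; rewrite E ltxx.
  have [->|mk] := eqVneq m k; first by rewrite A2ik mul0r.
  have [->|ml] := eqVneq m l; first by rewrite A2il mul0r.
  apply: mulr_ge0; first exact: dA2.2.
  rewrite leNgt; apply/negP => um.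
  suff : uniq [:: i; j; k; l; m] by move/uniq_size_ord.
  rewrite /= !inE !negb_or ij kl ![_ == m]eq_sym mk ml /= !andbT.
  by do !(apply/andP; split); apply/eqP => E; move: ui uj uk ul um; rewrite ?E; lra.
apply: (@cp_row_comb _ _ A2 i (fun=> 0)) => //; first exact: dA2.1.1.
  by move=> m; rewrite (psd_diag0 _ dA2.1 A2ii) big1// => a _; rewrite mul0r.
exact: IH3.
Qed.

Lemma dnn_cp_le4 r (A : 'M[R]_r) : (r <= 4)%N ->
  doubly_nonneg A <-> completely_positive A.
Proof.
move=> r4; split; last exact: cp_dnn.
have [r4e|r3] := eqVneq r 4%N; first by move: A; rewrite r4e; exact: dnn_cp4.
by apply: dnn_cp_le3; rewrite -ltnS ltn_neqAle r3.
Qed.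

End SmallDoublyNonnegative.

(** * Doubly nonnegative programs and the defect graph *)

Section Programs.
Variable R : realType.

Lemma frob_congr m n (Z : 'M[R]_m) (L : 'M[R]_(m, n)) (Y : 'M[R]_n) :
  frob Z (L *m Y *m L^T) = frob (L^T *m Z *m L) Y.
Proof.
rewrite /frob mulmxA mxtrace_mulC !mulmxA.
by rewrite !trmx_mul trmxK !mulmxA.
Qed.

Lemma frob_rank1 r (Z : 'M[R]_r) (x : 'cV[R]_r) :
  frob Z (x *m x^T) = quadform Z x.
Proof.
rewrite frobE quadformE; apply: eq_bigr => i _; apply: eq_bigr => j _.
by rewrite !mxE big_ord1 mxE mulrCA mulrA.
Qed.

Lemma frob_sumr r (I : finType) (Z : 'M[R]_r) (Y : I -> 'M[R]_r) :
  frob Z (\sum_i Y i) = \sum_i frob Z (Y i).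
Proof. by rewrite /frob mulmx_sumr linear_sum. Qed.

Lemma frobZr r (Z Y : 'M[R]_r) a : frob Z (a *: Y) = a * frob Z Y.
Proof. by rewrite /frob -scalemxAr linearZ. Qed.

Lemma frob_ones_rank1 r (x : 'cV[R]_r) :
  frob (ones r r) (x *m x^T) = vecsum x ^+ 2.
Proof.
rewrite frobE vecsumE expr2 mulr_suml; apply: eq_bigr => i _.
by rewrite mulr_sumr; apply: eq_bigr => j _; rewrite !mxE big_ord1 mxE mul1r.
Qed.

Lemma frob_ones_ge0 r (Y : 'M[R]_r) : entrywise_nonneg Y -> 0 <= frob (ones r r) Y.
Proof.
move=> Y0; rewrite frobE sumr_ge0// => i _.
by rewrite sumr_ge0// => j _; rewrite mxE mul1r.
Qed.

Lemma frob_ones_eq0 r (Y : 'M[R]_r) : entrywise_nonneg Y ->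
  frob (ones r r) Y = 0 -> Y = 0.
Proof.
move=> Y0 /eqP; rewrite frobE psumr_eq0 => [/allP s0|i _]; last first.
  by rewrite sumr_ge0// => j _; rewrite mxE mul1r.
apply/matrixP => i j; have := s0 i (mem_index_enum i).
rewrite psumr_eq0 => [/allP/(_ j (mem_index_enum j))|k _]; last by rewrite mxE mul1r.
by rewrite !mxE mul1r => /eqP.
Qed.

Lemma vecsumZ r a (x : 'cV[R]_r) : vecsum (a *: x) = a * vecsum x.
Proof. by rewrite /vecsum -scalemxAr mxE. Qed.

Lemma vecsumD r (x y : 'cV[R]_r) : vecsum (x + y) = vecsum x + vecsum y.
Proof. by rewrite /vecsum mulmxDr mxE. Qed.

Lemma vecsum_ge0 r (y : 'cV[R]_r) : (forall i, 0 <= y i 0) -> 0 <= vecsum y.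
Proof. by move=> y0; rewrite vecsumE sumr_ge0. Qed.

Lemma vecsum_eq0 r (y : 'cV[R]_r) : (forall i, 0 <= y i 0) -> vecsum y = 0 -> y = 0.
Proof.
move=> y0 /eqP; rewrite vecsumE psumr_eq0// => /allP s0.
apply/matrixP => i j; rewrite ord1 mxE.
by have /eqP := s0 i (mem_index_enum i).
Qed.

Lemma simplex_normalize r (y : 'cV[R]_r) : (forall i, 0 <= y i 0) -> y != 0 ->
  0 < vecsum y /\ simplex r ((vecsum y)^-1 *: y).
Proof.
move=> y0 yn; have sy : 0 < vecsum y.
  rewrite lt_neqAle vecsum_ge0// andbT eq_sym.
  by apply: contra_neq yn; exact: vecsum_eq0.
split=> //; split=> [i|]; last by rewrite vecsumZ mulVf// lt0r_neq0.
by rewrite mxE mulr_ge0// invr_ge0 ltW.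
Qed.

Lemma simplex_feasible r (x : 'cV[R]_r) : simplex r x -> dnn_feasible (x *m x^T).
Proof.
move=> [x0 x1]; split; first by rewrite frob_ones_rank1 x1 expr1n.
apply: cp_dnn; exists 1%N, (fun=> x); split=> //.
by rewrite big_ord1.
Qed.

Lemma dnn_value_le r (Z Y : 'M[R]_r) : (0 < r)%N -> dnn_feasible Y ->
  dnn_value Z <= frob Z Y.
Proof.
by move=> r0 fY; have [Y0 oY0 ->] := dnn_value_attained Z r0; exact: oY0.2.
Qed.

Lemma dnn_optimizer_value r (Z Y : 'M[R]_r) : (0 < r)%N -> dnn_optimizer Z Y ->
  frob Z Y = dnn_value Z.
Proof.
move=> r0 [fY oY]; apply/eqP; rewrite eq_le dnn_value_le// andbT.
by have [Y0 oY0 ->] := dnn_value_attained Z r0; exact: oY oY0.1.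
Qed.

(** Homogeneous form of the lower bound, for blocks of a feasible matrix, whose mass need not be
    one. Mass zero is separate: it forces [Y = 0]. *)
Lemma dnn_value_scale r (Z Y : 'M[R]_r) : (0 < r)%N -> doubly_nonneg Y ->
  dnn_value Z * frob (ones r r) Y <= frob Z Y.
Proof.
move=> r0 [pY Y0]; have s0 := frob_ones_ge0 Y0.
have [s00|sn0] := eqVneq (frob (ones r r) Y) 0.
  rewrite s00 mulr0 (frob_ones_eq0 Y0 s00).
  by rewrite -(scale0r Y) frobZr mul0r.
have sp : 0 < frob (ones r r) Y by rewrite lt_neqAle eq_sym sn0.
rewrite -ler_pdivlMr// mulrC -frobZr; apply: dnn_value_le => //.
split; first by rewrite frobZr mulVf.
split; last by move=> i j; rewrite mxE mulr_ge0// invr_ge0.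
split; first by rewrite linearZ /= pY.1.
move=> x; rewrite /quadform -scalemxAr -scalemxAl mxE mulr_ge0 ?invr_ge0//.
exact: pY.2.
Qed.

Lemma simplex_value_le r (Z : 'M[R]_r) x : (0 < r)%N -> simplex r x ->
  simplex_value Z <= quadform Z x.
Proof.
move=> r0 sx; apply: ge_inf; last by exists x.
have [x0 sx0 E] := simplex_value_attained Z r0.
(* [ge_inf] needs some lower bound of the set; the relaxed value is one. *)
exists (dnn_value Z) => _ [y sy <-].
by rewrite -frob_rank1; apply: dnn_value_le => //; exact: simplex_feasible.
Qed.

Lemma simplex_value_scale r (Z : 'M[R]_r) (y : 'cV[R]_r) : (0 < r)%N ->
  (forall i, 0 <= y i 0) -> simplex_value Z * vecsum y ^+ 2 <= quadform Z y.
Proof.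
move=> r0 y0; have [->|yn] := eqVneq y 0.
  by rewrite -(scale0r 0) vecsumZ quadformZ !mul0r expr0n/= mul0r mulr0.
have [sy sx] := simplex_normalize y0 yn.
have := simplex_value_le Z r0 sx; rewrite quadformZ.
by rewrite exprVn mulrC ler_pdivlMr// exprn_gt0.
Qed.

(** An optimizer is a sum of matrices y y', and the homogeneous simplex bound applies to each; the
    squared sums of the y add up to its mass, which is one. *)
Lemma dnn_value_exact r (Z : 'M[R]_r) : (0 < r <= 4)%N ->
  dnn_value Z = simplex_value Z.
Proof.
move=> /andP[r0 r4]; apply/eqP; rewrite eq_le; apply/andP; split.
  have [x sx ->] := simplex_value_attained Z r0.
  by rewrite -frob_rank1; apply: dnn_value_le => //; exact: simplex_feasible.
have [Y [[Y1 dY] _] ->] := dnn_value_attained Z r0.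
have /(dnn_cp_le4 Y r4)[k [y [y0 EY]]] := dY.
rewrite EY frob_sumr -[leLHS]mulr1 -Y1 EY frob_sumr mulr_sumr.
apply: ler_sum => s _; rewrite frob_ones_rank1 frob_rank1.
exact: simplex_value_scale.
Qed.

End Programs.

(** * Principal submatrices and zero padding *)

Section Principal.
Variables (R : realType) (n : nat).
Implicit Types (C : {set 'I_n}) (A B : 'M[R]_n).

(** The matrix of zero padding: restriction to a block and extension by zero both become
    congruences, which preserve semidefiniteness. *)
Definition inc C : 'M[R]_(n, #|C|) := \matrix_(i, a) (i == enum_val a)%:R.

Lemma mul_inc C (z : 'cV[R]_#|C|) a : (inc C *m z) (enum_val a) 0 = z a 0.
Proof.
rewrite mxE (bigD1 a)//= big1 ?addr0 ?mxE ?eqxx ?mul1r// => b ba.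
by rewrite mxE (inj_eq enum_val_inj) eq_sym (negbTE ba) mul0r.
Qed.

Lemma mul_inc_notin C (z : 'cV[R]_#|C|) i : i \notin C -> (inc C *m z) i 0 = 0.
Proof.
move=> iC; rewrite mxE big1// => b _; rewrite mxE.
by case: eqP iC => [->|]; rewrite ?enum_valP ?mul0r.
Qed.

Lemma mul_inct m C (B : 'M[R]_(n, m)) a j : ((inc C)^T *m B) a j = B (enum_val a) j.
Proof.
rewrite mxE (bigD1 (enum_val a))//= big1 ?addr0 ?mxE ?eqxx ?mul1r// => b ba.
by rewrite !mxE (negbTE ba) mul0r.
Qed.

Lemma principalE A C : principal A C = (inc C)^T *m A *m inc C.
Proof.
apply/matrixP => a b.
by rewrite -mulmxA mul_inct -[A *m _]trmxK trmx_mul [RHS]mxE mul_inct !mxE.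
Qed.

Lemma inc_vecsum C (z : 'cV[R]_#|C|) : vecsum (inc C *m z) = vecsum z.
Proof.
rewrite !vecsumE (bigID (mem C))/= [X in _ + X]big1 ?addr0 => [|i]; last first.
  exact: mul_inc_notin.
by rewrite [LHS]big_enum_val; apply: eq_bigr => a _; rewrite mul_inc.
Qed.

Lemma inc_restrict C (x : 'cV[R]_n) : (forall i, i \notin C -> x i 0 = 0) ->
  inc C *m ((inc C)^T *m x) = x.
Proof.
move=> xC; apply/matrixP => i j; rewrite ord1.
have [iC|iC] := boolP (i \in C); last by rewrite mul_inc_notin// xC.
by rewrite -(enum_rankK_in iC iC) mul_inc mul_inct.
Qed.

Lemma quadform_principal A C z : quadform (principal A C) z = quadform A (inc C *m z).
Proof. by rewrite principalE quadform_congr. Qed.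

Lemma dnn_principal A C : doubly_nonneg A -> doubly_nonneg (principal A C).
Proof.
move=> [pA A0]; split; last by move=> i j; rewrite mxE.
by rewrite principalE; exact: psd_congr.
Qed.

Lemma frob_principal A B C :
  frob (principal A C) (principal B C) = \sum_(i in C) \sum_(j in C) A i j * B i j.
Proof.
rewrite frobE [RHS]big_enum_val; apply: eq_bigr => a _.
by rewrite [RHS]big_enum_val; apply: eq_bigr => b _; rewrite !mxE.
Qed.

Lemma inc_feasible C (Y : 'M[R]_#|C|) : dnn_feasible Y ->
  dnn_feasible (inc C *m Y *m (inc C)^T).
Proof.
move=> [Y1 [pY Y0]]; split.
  rewrite frob_congr -principalE -Y1; congr frob.
  by apply/matrixP => i j; rewrite !mxE.
split; first by have := psd_congr (inc C)^T pY; rewrite trmxK.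
move=> i j; rewrite mxE sumr_ge0// => a _; apply: mulr_ge0; last by rewrite !mxE.
by rewrite mxE sumr_ge0// => b _; rewrite mulr_ge0// mxE.
Qed.

Lemma frob_inc A C (Y : 'M[R]_#|C|) :
  frob A (inc C *m Y *m (inc C)^T) = frob (principal A C) Y.
Proof. by rewrite frob_congr principalE. Qed.

End Principal.

Arguments inc {R n} C.

(** * Decomposition of the program along the components *)

Section Components.
Variables (R : realType) (n : nat) (Q : 'M[R]_n.+1).
Hypothesis symQ : Q^T = Q.

Lemma shiftedE i j : shifted Q i j = Q i j - diag_min Q.
Proof. by rewrite !mxE mulr1. Qed.

Lemma defect_edge_sym : symmetric (defect_edge Q).
Proof.
move=> i j; rewrite /defect_edge eq_sym !shiftedE; congr (_ && (_ - _ < 0)).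
by rewrite -{1}symQ mxE.
Qed.

Lemma component_refl i : i \in component Q i.
Proof. by rewrite inE connect0. Qed.

Lemma component_eq i j : j \in component Q i -> component Q j = component Q i.
Proof.
rewrite inE => ij; apply/setP => k; rewrite !inE.
by rewrite (same_connect (sym_connect_sym defect_edge_sym) ij).
Qed.

Lemma component_in i : component Q i \in components Q.
Proof. exact: imset_f. Qed.

Lemma components_mem C i : C \in components Q -> (i \in C) = (component Q i == C).
Proof.
move=> /imsetP[j _ ->]; apply/idP/eqP => [/component_eq//|<-].
exact: component_refl.
Qed.

Lemma components_gt0 C : C \in components Q -> (0 < #|C|)%N.
Proof. by move=> /imsetP[i _ ->]; apply/card_gt0P; exists i; exact: component_refl. Qed.

Lemma components_le C k : (max_component_size Q <= k)%N -> C \in components Q ->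
  (#|C| <= k)%N.
Proof. by move=> m4 CC; apply: leq_trans m4; exact: leq_bigmax_cond. Qed.

Lemma sum_components (F : {set 'I_n.+1} -> 'I_n.+1 -> R) :
  \sum_(C in components Q) \sum_(i in C) F C i = \sum_i F (component Q i) i.
Proof.
rewrite [RHS](partition_big (component Q) (mem (components Q))) /= => [|i _].
  apply: eq_bigr => C CC; rewrite (eq_bigl (fun i => component Q i == C)) => [|i].
    by apply: eq_bigr => i /eqP ->.
  exact: components_mem.
exact: component_in.
Qed.

Lemma off_component_ge0 i j : j \notin component Q i -> 0 <= shifted Q i j.
Proof.
move=> jC; rewrite leNgt; apply: contra jC => Mij.
have [->|ij] := eqVneq i j; first exact: component_refl.
by rewrite inE connect1// /defect_edge ij.
Qed.

Lemma diag_min_le i : diag_min Q <= Q i i.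
Proof. by rewrite /diag_min; exact: bigmin_le_cond. Qed.

Lemma diag_min_attained : exists i, diag_min Q = Q i i.
Proof.
rewrite /diag_min; elim/big_ind: _ => [|x y [i ->] [j ->]|i _]; last by exists i.
  by exists ord0.
by rewrite /Num.min; case: ifP => _; [exists i|exists j].
Qed.

Let M := shifted Q.

Lemma frob_components_le (Y : 'M[R]_n.+1) : entrywise_nonneg Y ->
  \sum_(C in components Q) frob (principal M C) (principal Y C) <= frob M Y.
Proof.
move=> Y0; under eq_bigr do rewrite frob_principal.
rewrite (sum_components (fun C i => \sum_(j in C) M i j * Y i j)) frobE.
apply: ler_sum => i _; rewrite [leRHS](bigID (mem (component Q i)))/= lerDl.
by rewrite sumr_ge0// => j ji; rewrite mulr_ge0// off_component_ge0.
Qed.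

Lemma frob_ones_components_le (Y : 'M[R]_n.+1) : entrywise_nonneg Y ->
  \sum_(C in components Q) frob (ones #|C| #|C|) (principal Y C) <=
  frob (ones n.+1 n.+1) Y.
Proof.
move=> Y0.
have oE (C : {set 'I_n.+1}) : ones #|C| #|C| = principal (ones n.+1 n.+1 : 'M[R]_n.+1) C.
  by apply/matrixP => i j; rewrite !mxE.
under eq_bigr do rewrite oE frob_principal.
rewrite (sum_components (fun C i => \sum_(j in C) ones n.+1 n.+1 i j * Y i j)) frobE.
apply: ler_sum => i _; rewrite [leRHS](bigID (mem (component Q i)))/= lerDl.
by rewrite sumr_ge0// => j ji; rewrite mulr_ge0// mxE.
Qed.

(** The unit vector at a smallest diagonal entry has value 0 after the shift. The sign is essential
    later: the diagonal blocks only carry mass at most one, and a nonpositive factor reverses this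
    inequality. *)
Lemma dnn_value_shifted_le0 : dnn_value M <= 0.
Proof.
have [i mi] := diag_min_attained.
pose x : 'cV[R]_n.+1 := delta_mx i 0.
have sx : simplex _ x.
  split=> [j|]; first by rewrite mxE ler0n.
  rewrite vecsumE (bigD1 i)//= mxE !eqxx big1 ?addr0// => j ji.
  by rewrite mxE (negbTE ji).
apply: (le_trans (dnn_value_le M _ (simplex_feasible sx))) => //.
by rewrite frob_rank1 quadform_delta shiftedE mi subrr.
Qed.

Lemma dnn_value_le_principal (C : {set 'I_n.+1}) : (0 < #|C|)%N ->
  dnn_value M <= dnn_value (principal M C).
Proof.
move=> C0; have [Y oY ->] := dnn_value_attained (principal M C) C0.
rewrite -frob_inc; apply: dnn_value_le => //.
by apply: inc_feasible; exact: oY.1.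
Qed.

(** One inequality is zero padding. For the other, dropping the entries between components does not
    increase the objective, each block costs at least the minimum m per unit of mass, and the total
    mass is at most one while m <= 0. *)
Lemma dnn_value_components :
  dnn_value M = min_component_value Q (fun C => dnn_value (principal M C)).
Proof.
set f := fun C => _; have fC C : C \in components Q -> dnn_value M <= f C.
  by move=> CC; apply: dnn_value_le_principal; exact: components_gt0.
apply/eqP; rewrite eq_le; apply/andP; split.
  rewrite /min_component_value; elim/big_ind: _ => //.
    by apply: fC; exact: component_in.
  by move=> x y xm ym; rewrite le_min xm.
have mf C : C \in components Q -> min_component_value Q f <= f C.
  by move=> CC; exact: bigmin_le_cond.
have [i mi] := diag_min_attained.
have m0 : min_component_value Q f <= 0.
  apply: le_trans (mf _ (component_in i)) _.
  pose a := enum_rank_in (component_refl i) i.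
  pose x : 'cV[R]_#|component Q i| := delta_mx a 0.
  have sx : simplex _ x.
    split=> [j|]; first by rewrite mxE ler0n.
    rewrite vecsumE (bigD1 a)//= mxE !eqxx big1 ?addr0// => j ja.
    by rewrite mxE (negbTE ja).
  apply: (le_trans (dnn_value_le _ _ (simplex_feasible sx))).
    exact/components_gt0/component_in.
  rewrite frob_rank1 quadform_delta mxE shiftedE enum_rankK_in ?component_refl//.
  by rewrite mi subrr.
have [Y [[Y1 dY] _] ->] := dnn_value_attained M (ltn0Sn n).
apply: le_trans (frob_components_le dY.2).
apply: (@le_trans _ _ (\sum_(C in components Q)
    min_component_value Q f * frob (ones #|C| #|C|) (principal Y C))).
  rewrite -mulr_sumr -[leLHS]mulr1 -Y1 ler_wnM2l//.
  exact: frob_ones_components_le dY.2.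
apply: ler_sum => C CC; have dYC := dnn_principal C dY.
apply: le_trans (dnn_value_scale (principal M C) (components_gt0 CC) dYC).
by rewrite ler_wpM2r ?mf// frob_ones_ge0//; exact: dYC.2.
Qed.

End Components.

(** * Uniqueness of the optimizer *)

Section Minimizers.
Variables (R : realType) (n : nat) (Q : 'M[R]_n.+1).
Hypothesis symQ : Q^T = Q.
Implicit Types x u : 'cV[R]_n.+1.

Definition supp x : {set 'I_n.+1} := [set i | x i 0 != 0]%SET.

Definition simplex_minimizer x : Prop :=
  simplex _ x /\ forall y, simplex _ y -> quadform Q x <= quadform Q y.

(* Directions tangent to the face of the simplex spanned by the support of x. *)
Definition face_direction x u : Prop :=
  vecsum u = 0 /\ forall i, x i 0 = 0 -> u i 0 = 0.

Lemma face_directionN x u : face_direction x u -> face_direction x (- u).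
Proof.
move=> [su xu]; rewrite -scaleN1r; split; first by rewrite vecsumZ su mulr0.
by move=> i /xu; rewrite mxE => ->; rewrite mulr0.
Qed.

(** Ratio test of the simplex method: [u] sums to zero, so it has a negative entry, and [t] is the
    first time at which a coordinate of [x + t *: u] reaches zero. *)
Lemma simplex_face_step x u : simplex _ x -> u != 0 -> face_direction x u ->
  exists t, [/\ 0 < t, simplex _ (x + t *: u) & supp (x + t *: u) \proper supp x].
Proof.
move=> [x0 x1] u0 [su xu].
have [i0 ui0] : exists i, u i 0 < 0.
  apply/existsP; apply: contraNT u0; rewrite negb_exists => /forallP u0.
  by apply/eqP; apply: vecsum_eq0 => // i; rewrite leNgt.
have [i ui tmin] := @Order.TotalTheory.arg_minP _ _ _ i0 (fun i => u i 0 < 0)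
  (fun i => x i 0 / - u i 0) ui0.
have xi : 0 < x i 0.
  rewrite lt_neqAle x0 andbT eq_sym; apply/eqP => /xu E.
  by move: ui; rewrite E ltxx.
exists (x i 0 / - u i 0); set t := _ / _ in tmin *.
have t0 : 0 < t by rewrite divr_gt0// oppr_gt0.
have E j : (x + t *: u) j 0 = x j 0 + t * u j 0 by rewrite !mxE.
split=> //.
  split; last by rewrite vecsumD vecsumZ su mulr0 addr0.
  move=> j; rewrite E; have [uj|uj] := leP 0 (u j 0).
    by rewrite addr_ge0// mulr_ge0// ltW.
  have := tmin j uj; rewrite ler_pdivlMr ?oppr_gt0// mulrN; lra.
apply/properP; split.
  apply/fintype.subsetP => j; rewrite !inE E; apply: contra => /eqP xj.
  by rewrite xj xu// mulr0 addr0.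
exists i; first by rewrite inE gt_eqF.
by rewrite inE E negbK /t; apply/eqP; field; rewrite lt_eqF.
Qed.

Lemma simplex_segment x u s t : 0 <= s <= t -> vecsum u = 0 -> simplex _ x ->
  simplex _ (x + t *: u) -> simplex _ (x + s *: u).
Proof.
move=> /andP[s0 st] su [x0 x1] [xt _]; split; last first.
  by rewrite vecsumD vecsumZ su mulr0 addr0.
move=> j; have := xt j; rewrite !mxE; have := x0 j.
have [uj|uj] := leP 0 (u j 0); first by move=> *; rewrite addr_ge0// mulr_ge0.
move=> _ h; apply: (le_trans h); rewrite lerD2l; nra.
Qed.

Lemma minimizer_bil_ge0 x u : simplex_minimizer x -> face_direction x u ->
  0 <= bil Q u x.
Proof.
move=> [sx minx] du; have [->|u0] := eqVneq u 0.
  by rewrite -(scale0r x) bilZl mul0r.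
have [t [t0 st _]] := simplex_face_step sx u0 du.
rewrite leNgt; apply/negP => b0.
set b := bil Q u x in b0; set a := quadform Q u.
(* So short a step that the linear term dominates: [s * a] is at most [- b], hence [2 * b + s * a]
   is at most [b], which is negative. *)
pose s := Num.min t (- b / (`|a| + 1)).
have a1 : 0 < `|a| + 1 by rewrite ltr_wpDl.
have s0 : 0 < s by rewrite lt_min t0 divr_gt0// oppr_gt0.
have sst : 0 <= s <= t by rewrite (ltW s0) ge_min lexx.
have := minx _ (simplex_segment sst du.1 sx st).
rewrite quadformD// bilZl quadformZ -/a -/b -addrA lerDl.
have -> : 2 * (s * b) + s ^+ 2 * a = s * (2 * b + s * a) by ring.
rewrite pmulr_rge0//; apply/negP; rewrite -ltNge.
have : s * (`|a| + 1) <= - b by rewrite -ler_pdivlMr// ge_min lexx orbT.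
have := ler_norm a; nra.
Qed.

Lemma minimizer_bil_eq0 x u : simplex_minimizer x -> face_direction x u ->
  bil Q u x = 0.
Proof.
move=> mx du; apply/eqP; rewrite eq_le minimizer_bil_ge0// andbT.
have := minimizer_bil_ge0 mx (face_directionN du).
by rewrite -scaleN1r bilZl mulN1r oppr_ge0.
Qed.

Lemma minimizer_quadform_ge0 x u : simplex_minimizer x -> face_direction x u ->
  0 <= quadform Q u.
Proof.
move=> mx du; have [->|u0] := eqVneq u 0.
  by rewrite -(scale0r x) quadformZ expr0n mul0r.
have [t [t0 st _]] := simplex_face_step mx.1 u0 du.
have := mx.2 _ st; rewrite quadformD// bilZl minimizer_bil_eq0// !mulr0 addr0.
by rewrite lerDl quadformZ pmulr_rge0// exprn_gt0.
Qed.

Lemma minimizer_flat_step x u : simplex_minimizer x -> face_direction x u ->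
  u != 0 -> quadform Q u = 0 ->
  exists t, [/\ 0 < t, simplex_minimizer (x + t *: u)
              & (#|supp (x + t *: u)| < #|supp x|)%N].
Proof.
move=> mx du u0 qu; have [t [t0 st pt]] := simplex_face_step mx.1 u0 du.
exists t; split=> //; last exact: proper_card.
split=> // y sy; rewrite quadformD// bilZl minimizer_bil_eq0// !mulr0 addr0.
by rewrite quadformZ qu mulr0 addr0; exact: mx.2.
Qed.

(** Stationarity along the direction from [x] to the [i]-th vertex of its face. *)
Lemma minimizer_kkt x i : simplex_minimizer x -> x i 0 != 0 ->
  (Q *m x) i 0 = quadform Q x.
Proof.
move=> mx xi; pose e : 'cV[R]_n.+1 := delta_mx i 0.
have se : vecsum e = 1.
  rewrite vecsumE (bigD1 i)//= mxE !eqxx big1 ?addr0// => j ji.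
  by rewrite mxE (negbTE ji).
have de : face_direction x (e - x).
  split=> [|j xj]; first by rewrite vecsumD -scaleN1r vecsumZ se mx.1.2 mulr1 subrr.
  rewrite !mxE xj subr0; case: eqP => // ji.
  by move: xi; rewrite -ji xj eqxx.
have := minimizer_bil_eq0 mx de; rewrite bilDl -scaleN1r bilZl mulN1r.
move/eqP; rewrite -quadform_bil subr_eq0 => /eqP <-.
rewrite bilE (bigD1 i)//= [e i 0]mxE !eqxx mul1r big1 ?addr0// => j ji.
by rewrite [e j 0]mxE (negbTE ji) mul0r.
Qed.

Lemma unitmx_ker r (K : 'M[R]_r) :
  (forall z : 'cV[R]_r, K *m z = 0 -> z = 0) -> K \in unitmx.
Proof.
move=> K0; rewrite -unitmx_tr -row_free_unit; apply: inj_row_free => v vK.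
by rewrite -[v]trmxK (K0 v^T) ?trmx0//; apply: trmx_inj; rewrite trmx_mul trmxK vK trmx0.
Qed.

(** A kernel vector (p, q) satisfies 1'p = 0 and Q[T] p = q 1, so p' Q[T] p = q 1'p = 0. Positivity
    gives p = 0, and then q = 0. *)
Lemma kkt_matrix_unit (T : {set 'I_n.+1}) : (0 < #|T|)%N ->
  (forall u : 'cV[R]_#|T|, u != 0 -> vecsum u = 0 ->
     0 < quadform (principal Q T) u) ->
  kkt_matrix Q T \in unitmx.
Proof.
move=> T0 pdT.
apply: unitmx_ker => z.
rewrite -[z]vsubmxK; set p := usubmx z; set q := dsubmx z.
rewrite /kkt_matrix mul_block_col mul0mx addr0 -[0 in RHS]vsubmxK => /eq_col_mx[E1 E2].
have sp : vecsum p = 0 by rewrite /vecsum E2 !mxE.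
have qp : quadform (principal Q T) p = 0.
  have Ep : principal Q T *m p = q 0 0 *: ones #|T| 1.
    move/eqP: E1; rewrite linear0 addr_eq0 => /eqP ->.
    rewrite mulNmx opprK; apply/matrixP => a b.
    by rewrite (ord1 b) !mxE big_ord1 mxE mul1r mulr1 mxE.
  rewrite quadform_bil /bil -mulmxA Ep -scalemxAr mxE.
  have -> : (p^T *m ones #|T| 1) 0 0 = vecsum p.
    by rewrite vecsumE mxE; apply: eq_bigr => a _; rewrite !mxE mulr1.
  by rewrite sp mulr0.
have p0 : p = 0.
  apply/eqP/negPn/negP => p0; have := pdT p p0 sp.
  by rewrite qp ltxx.
have q0 : q = 0.
  move: E1; rewrite p0 mulmx0 add0r linear0 mulNmx => /eqP; rewrite oppr_eq0 => /eqP E1.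
  apply/matrixP => a b; rewrite !ord1 [RHS]mxE.
  have /matrixP/(_ (Ordinal T0) 0) := E1.
  by rewrite !mxE big_ord1 !mxE mul1r.
by rewrite p0 q0 col_mx0.
Qed.

(** The restriction of [x] to its support solves the KKT system, with the attained value as
    multiplier; strictness on the face is the second-order part of admissibility. *)
Lemma minimizer_candidate x : simplex_minimizer x ->
  (forall u, u != 0 -> face_direction x u -> 0 < quadform Q u) ->
  candidate Q (supp x) (quadform Q x).
Proof.
move=> mx pd; have [[x0 x1] minx] := mx; set T := supp x.
have xT i : i \notin T -> x i 0 = 0 by rewrite inE negbK => /eqP.
have T0 : (0 < #|T|)%N.
  rewrite card_gt0; apply: contra_neq (oner_neq0 R) => T0; rewrite -x1 vecsumE big1// => i _.
  by rewrite xT// T0 inE.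
have [T2|] := leqP 2 #|T|; last first.
  rewrite ltnS => T1; have /cards1P[i Ti] : #|T| == 1%N by rewrite eqn_leq T1.
  left; exists i => //.
  have xj j : j != i -> x j 0 = 0 by move=> ji; apply: xT; rewrite Ti inE.
  have -> : x = delta_mx i 0; last by rewrite quadform_delta.
  apply/matrixP => j k; rewrite ord1 mxE andbT; case: eqVneq => [->|/xj//].
  by rewrite -x1 vecsumE (bigD1 i)//= big1 ?addr0// => l /xj.
have face (u : 'cV[R]_#|T|) : vecsum u = 0 -> face_direction x (inc T *m u).
  move=> su; split=> [|i xi]; first by rewrite inc_vecsum.
  by rewrite mul_inc_notin// inE negbK xi.
have inc0 (u : 'cV[R]_#|T|) : inc T *m u = 0 -> u = 0.
  move=> Tu; apply/matrixP => a j; rewrite ord1 -mul_inc Tu !mxE//.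
have pdT (u : 'cV[R]_#|T|) : u != 0 -> vecsum u = 0 -> 0 < quadform (principal Q T) u.
  move=> u0 su; rewrite quadform_principal; apply: pd; last exact: face.
  by apply: contra_neq u0 => /inc0.
right; split => //.
  exact: kkt_matrix_unit.
have Ex : inc T *m ((inc T)^T *m x) = x by exact: inc_restrict.
exists ((inc T)^T *m x); split.
- rewrite principalE -(mulmxA _ (inc T)) Ex -mulmxA; apply/matrixP => a j.
  rewrite ord1 mul_inct !mxE mulr1 -(minimizer_kkt (i := enum_val a) mx) ?mxE//.
  by have := enum_valP a; rewrite inE.
- by rewrite -inc_vecsum Ex.
- move=> a; rewrite mul_inct lt_neqAle x0 andbT eq_sym.
  by have := enum_valP a; rewrite inE.
Qed.

Definition small_supp x : Prop :=
  exists C, [/\ C \in components Q, (#|C| <= 4)%N & supp x \subset C].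

(* A non-strict minimum on its face can be moved along a flat direction, both
   ways, to two different minimizers of smaller support. *)
Lemma simplex_minimizer_unique x1 x2 : local_candidates_distinct Q ->
  simplex_minimizer x1 -> simplex_minimizer x2 ->
  small_supp x1 -> small_supp x2 -> x1 = x2.
Proof.
(* The induction is on the larger of the two supports: it gets applied to two perturbations of a
   single minimizer, both with smaller support than that one. *)
move=> dist; have [k] := ubnP (maxn #|supp x1| #|supp x2|).
elim: k x1 x2 => // k IH x1 x2; rewrite ltnS geq_max => /andP[k1 k2] m1 m2 c1 c2.
have pd x : (#|supp x| <= k)%N -> simplex_minimizer x -> small_supp x ->
    forall u, u != 0 -> face_direction x u -> 0 < quadform Q u.
  move=> kx mx [C [CC C4 xC]] u u0 du.
  rewrite lt_neqAle (minimizer_quadform_ge0 mx du) andbT eq_sym.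
  apply/eqP => qu.
  have small y : face_direction x y -> forall t, small_supp (x + t *: y).
    move=> dy t; exists C; split=> //; apply/fintype.subsetP => i; rewrite inE => xi.
    apply: (fintype.subsetP xC); rewrite inE; apply: contra xi => /eqP xi.
    by rewrite !mxE xi dy.2// mulr0 addr0.
  have duN := face_directionN du.
  have [t [t0 mt st]] := minimizer_flat_step mx du u0 qu.
  have [||s [s0 ms ss]] := minimizer_flat_step mx duN.
  - by rewrite oppr_eq0.
  - by rewrite -scaleN1r quadformZ qu mulr0.
  have /IH/(_ mt ms (small _ du _) (small _ duN _)) :
      (maxn #|supp (x + t *: u)| #|supp (x + s *: - u)| < k)%N.
    by rewrite gtn_max !(leq_trans _ kx).
  move/addrI/eqP; rewrite scalerN -subr_eq0 opprK -scalerDl scaler_eq0 (negbTE u0) orbF.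
  by rewrite gt_eqF// addr_gt0.
have p1 := pd _ k1 m1 c1; have p2 := pd _ k2 m2 c2.
have [[C1 [CC1 C14 xC1]] [C2 [CC2 C24 xC2]]] := (c1, c2).
have q12 : quadform Q x1 = quadform Q x2.
  by apply/eqP; rewrite eq_le (m1.2 _ m2.1) (m2.2 _ m1.1).
have T12 : supp x1 = supp x2.
  apply: contrapT => T12.
  exact: (dist _ _ _ _ _ _ CC1 CC2 C14 C24 xC1 xC2
    (minimizer_candidate m1 p1) (minimizer_candidate m2 p2) T12).
(* Equal values force equal supports, so [x1 - x2] is a face direction of both points. Its form is
   the difference of two vanishing first-order terms, against strictness. *)
apply/eqP; rewrite -subr_eq0; apply/negPn/negP => u0.
have su : vecsum (x1 - x2) = 0.
  by rewrite -scaleN1r vecsumD vecsumZ m1.1.2 m2.1.2 mulN1r subrr.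
have eq0 i : (x1 i 0 == 0) = (x2 i 0 == 0).
  by have /setP/(_ i) := T12; rewrite !inE => /negb_inj.
have d1 : face_direction x1 (x1 - x2).
  by split=> // i /eqP xi; move: (xi); rewrite eq0 !mxE (eqP xi) => /eqP ->; rewrite subrr.
have d2 : face_direction x2 (x1 - x2).
  by split=> // i /eqP xi; move: (xi); rewrite -eq0 !mxE (eqP xi) => /eqP ->; rewrite subrr.
have := p1 _ u0 d1; rewrite quadform_bil bilDr -scaleN1r bilZr scaleN1r.
by rewrite !minimizer_bil_eq0// mulr0 addr0 ltxx.
Qed.

End Minimizers.

Section UniqueOptimizer.
Variables (R : realType) (n : nat) (Q : 'M[R]_n.+1).
Hypothesis symQ : Q^T = Q.
Let M := shifted Q.
Let v := dnn_value M.

Lemma frob_shifted (Y : 'M[R]_n.+1) : dnn_feasible Y ->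
  frob M Y = frob Q Y - diag_min Q.
Proof.
move=> [Y1 _]; rewrite -[diag_min Q]mulr1 -Y1 !frobE mulr_sumr -sumrB.
apply: eq_bigr => i _; rewrite mulr_sumr -sumrB; apply: eq_bigr => j _.
by rewrite [M i j]mxE !mxE; ring.
Qed.

Lemma quadform_shifted (x : 'cV[R]_n.+1) : simplex _ x ->
  quadform M x = quadform Q x - diag_min Q.
Proof. by move=> sx; rewrite -!frob_rank1 frob_shifted//; exact: simplex_feasible. Qed.

Lemma dnn_optimizer_shifted (Y : 'M[R]_n.+1) : dnn_optimizer Q Y -> frob M Y = v.
Proof.
move=> [fY oY]; apply: dnn_optimizer_value => //; split=> // Y' fY'.
by rewrite !frob_shifted// lerB// oY.
Qed.

Lemma minimizer_of_value (x : 'cV[R]_n.+1) : simplex _ x -> quadform M x = v ->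
  simplex_minimizer Q x.
Proof.
move=> sx xv; split=> // y sy; rewrite -(lerD2r (- diag_min Q)).
rewrite -!quadform_shifted// xv -frob_rank1; apply: dnn_value_le => //.
exact: simplex_feasible.
Qed.

(* The optimal value is at most 0 and the blocks of Y have total mass at most 1,
   so no block can do worse than v per unit of mass. *)
Lemma optimizer_component (Y : 'M[R]_n.+1) C : dnn_optimizer Q Y ->
  C \in components Q ->
  frob (principal M C) (principal Y C) =
  v * frob (ones #|C| #|C|) (principal Y C).
Proof.
move=> oY CC; have [[Y1 dY] _] := oY.
have gap_ge0 C' : C' \in components Q ->
    0 <= frob (principal M C') (principal Y C') -
         v * frob (ones #|C'| #|C'|) (principal Y C').
  move=> CC'; have dYC := dnn_principal C' dY.
  have C0 := components_gt0 CC'.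
  rewrite subr_ge0; apply: le_trans (dnn_value_scale _ C0 dYC).
  rewrite ler_wpM2r ?dnn_value_le_principal//.
  exact: frob_ones_ge0 dYC.2.
apply/eqP; rewrite -subr_eq0.
have : \sum_(C' in components Q) (frob (principal M C') (principal Y C') -
         v * frob (ones #|C'| #|C'|) (principal Y C')) == 0.
  rewrite eq_le sumr_ge0// andbT sumrB -mulr_sumr subr_le0.
  apply: (le_trans (frob_components_le symQ dY.2)).
  rewrite (dnn_optimizer_shifted oY) -[leLHS]mulr1 -Y1 ler_wnM2l//.
    exact: dnn_value_shifted_le0.
  exact: frob_ones_components_le dY.2.
rewrite psumr_eq0// => /allP/(_ C (mem_index_enum C)).
by rewrite CC.
Qed.

Hypothesis small : (max_component_size Q <= 4)%N.
Hypothesis dist : local_candidates_distinct Q.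

Definition component_minimizer (x : 'cV[R]_n.+1) : Prop :=
  simplex_minimizer Q x /\ small_supp Q x.

Lemma component_minimizer_unique x1 x2 :
  component_minimizer x1 -> component_minimizer x2 -> x1 = x2.
Proof. by move=> [m1 s1] [m2 s2]; exact: (simplex_minimizer_unique symQ). Qed.

Lemma optimizer_block (Y : 'M[R]_n.+1) C : dnn_optimizer Q Y ->
  C \in components Q ->
  exists (k : nat) (y : 'I_k -> 'cV[R]_#|C|),
    [/\ principal Y C = \sum_s y s *m (y s)^T,
        forall s, 0 <= vecsum (y s) &
        forall s, y s != 0 ->
          component_minimizer ((vecsum (y s))^-1 *: (inc C *m y s))].
Proof.
move=> oY CC; have [[Y1 dY] _] := oY.
have C0 := components_gt0 CC; have C4 := components_le small CC.
have /(dnn_cp_le4 _ C4)[k [y [y0 EY]]] := dnn_principal C dY.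
exists k, y; split=> // [s|s ys0]; first exact: vecsum_ge0.
have gap s' : 0 <= quadform (principal M C) (y s') - v * vecsum (y s') ^+ 2.
  rewrite subr_ge0 -frob_rank1 -frob_ones_rank1.
  have dys : doubly_nonneg (y s' *m (y s')^T).
    by apply: cp_dnn; exists 1%N, (fun=> y s'); rewrite big_ord1; split.
  apply: le_trans (dnn_value_scale _ C0 dys).
  by rewrite ler_wpM2r ?dnn_value_le_principal// frob_ones_ge0//; exact: dys.2.
(* The gaps are nonnegative and the whole block attains [v] per unit of mass, so every single gap
   vanishes. *)
have /eqP : \sum_s' (quadform (principal M C) (y s') - v * vecsum (y s') ^+ 2) = 0.
  apply/eqP; rewrite sumrB -mulr_sumr subr_eq0; apply/eqP.
  have := optimizer_component oY CC; rewrite EY !frob_sumr.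
  by under eq_bigr do rewrite frob_rank1; under [in RHS]eq_bigr do
    rewrite frob_ones_rank1.
rewrite psumr_eq0// => /allP/(_ s (mem_index_enum s)) /=; rewrite subr_eq0 => /eqP Es.
have Y0 i : 0 <= (inc C *m y s) i 0.
  by rewrite mxE sumr_ge0// => a _; rewrite mulr_ge0// mxE.
have incn0 : inc C *m y s != 0.
  apply: contra_neq ys0 => E; apply/matrixP => a b.
  by rewrite (ord1 b) -mul_inc E !mxE.
have [sp ss] := simplex_normalize Y0 incn0; rewrite inc_vecsum in sp ss.
split; last first.
  exists C; split => //; apply/fintype.subsetP => i; rewrite inE; apply: contraR => iC.
  by rewrite mxE mul_inc_notin// mulr0.
apply: minimizer_of_value => //; rewrite quadformZ -quadform_principal Es.
by rewrite exprVn mulrCA mulVf ?mulr1// expf_neq0// lt0r_neq0.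
Qed.

(** By uniqueness every nonzero summand, normalized and padded, is the same [x]. [C] need not
    contain the support of [x]; on a component where [x] vanishes the block is zero. *)
Lemma optimizer_block_rank1 (Y : 'M[R]_n.+1) C x : dnn_optimizer Q Y ->
  C \in components Q -> component_minimizer x ->
  exists a, forall i j, i \in C -> j \in C -> Y i j = a * (x i 0 * x j 0).
Proof.
move=> oY CC mx; have [k [y [EY y0 my]]] := optimizer_block oY CC.
exists (\sum_s vecsum (y s) ^+ 2) => i j iC jC.
have -> : Y i j = principal Y C (enum_rank_in iC i) (enum_rank_in iC j).
  by rewrite mxE !enum_rankK_in.
rewrite EY summxE mulr_suml; apply: eq_bigr => s _.
have ys l : l \in C -> y s (enum_rank_in iC l) 0 = vecsum (y s) * x l 0.
  move=> lC; have [->|ys0] := eqVneq (y s) 0.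
    by rewrite -(scale0r (y s)) vecsumZ mxE !mul0r.
  rewrite -mul_inc enum_rankK_in// (component_minimizer_unique mx (my s ys0)).
  have vs0 : vecsum (y s) != 0.
    apply: contra_neq (oner_neq0 R) => vs0.
    by rewrite -(my s ys0).1.1.2 vecsumZ vs0 invr0 mul0r.
  by rewrite [in RHS]mxE mulrA mulfV// mul1r.
by rewrite mxE big_ord1 mxE !ys//; ring.
Qed.

Lemma component_minimizer_exists (Y : 'M[R]_n.+1) : dnn_optimizer Q Y ->
  exists x, component_minimizer x.
Proof.
move=> oY; have [[Y1 [pY _]] _] := oY.
have [i Yi] : exists i, Y i i != 0.
  apply/existsP; apply: contraT; rewrite negb_exists => /forallP Y0.
  have := oner_neq0 R; rewrite -Y1 (_ : Y = 0) ?eqxx//.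
    by rewrite -(scale0r 0) frobZr mul0r eqxx.
  apply/matrixP => i j; rewrite mxE; apply: psd_diag0 => //.
  by apply/eqP; rewrite -[_ == _]negbK.
have [k [y [EY y0 my]]] := optimizer_block oY (component_in Q i).
have [s ys] : exists s, y s != 0.
  apply/existsP; apply: contraNT Yi; rewrite negb_exists => /forallP ys.
  have iC := component_refl Q i.
  have -> : Y i i = principal Y (component Q i) (enum_rank_in iC i) (enum_rank_in iC i).
    by rewrite mxE !enum_rankK_in.
  rewrite EY big1 ?mxE// => s _.
  by have := ys s; rewrite negbK => /eqP ->; rewrite mul0mx.
by eexists; exact: my ys.
Qed.

Lemma optimizer_rank1 (Y : 'M[R]_n.+1) x : dnn_optimizer Q Y ->
  component_minimizer x -> Y = x *m x^T.
Proof.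
move=> oY mx; have [[Y1 [pY Y0]] _] := oY.
have [[sx _] [C0 [CC0 _ xC0]]] := mx.
have xout i : i \notin C0 -> x i 0 = 0.
  by move=> iC; apply/eqP; apply: contraR iC => xi; apply: (fintype.subsetP xC0); rewrite inE.
have Ysym i j : Y i j = Y j i by rewrite -{1}pY.1 mxE.
(* The diagonal entry vanishes by the block of the component of [i] itself, and semidefiniteness
   clears the whole row. This also disposes of the entries between components. *)
have Yout i j : i \notin C0 -> Y i j = 0.
  move=> iC; apply: psd_diag0 => //.
  have [a Ya] := optimizer_block_rank1 oY (component_in Q i) mx.
  by rewrite Ya ?component_refl// xout// mul0r mulr0.
have [a Ya] := optimizer_block_rank1 oY CC0 mx.
have EY : Y = a *: (x *m x^T).
  apply/matrixP => i j; rewrite !mxE big_ord1 mxE.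
  have [iC|iC] := boolP (i \in C0); last by rewrite Yout// xout// mul0r mulr0.
  have [jC|jC] := boolP (j \in C0); last by rewrite Ysym Yout// (xout j)// !mulr0.
  exact: Ya.
move: Y1; rewrite EY frobZr frob_ones_rank1 sx.2 expr1n mulr1 => ->.
by rewrite scale1r.
Qed.

Lemma unique_rank_one : unique_rank_one_optimizer Q.
Proof.
have [Y oY _] := dnn_value_attained Q (ltn0Sn n).
have [x mx] := component_minimizer_exists oY.
have EY := optimizer_rank1 oY mx.
exists Y; split=> // [Y' oY'|]; first by rewrite EY; exact: optimizer_rank1.
apply/eqP; rewrite eqn_leq EY mulmx_max_rank lt0n mxrank_eq0 -EY.
apply: contra_neq (oner_neq0 R) => Y0.
by rewrite -oY.1.1 Y0 -(scale0r 0) frobZr mul0r.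
Qed.

End UniqueOptimizer.

(** * Measurability of the uniqueness event *)

Section RankOneDefect.
Variable R : realType.

Lemma quadform_frob r (A : 'M[R]_r) x : quadform A x = frob (x *m x^T) A.
Proof.
rewrite quadformE frobE.
by do 2!apply: eq_bigr => ? _; rewrite !mxE big_ord1 mxE mulrAC.
Qed.

(** For symmetric [Y], the sum of squares of the principal minors of order two. It expresses rank
    one on feasible matrices by the vanishing of a continuous function. *)
Definition minor_defect r (Y : 'M[R]_r) : R :=
  \sum_i \sum_j (Y i i * Y j j - Y i j ^+ 2) ^+ 2.

Lemma minor_defect_eq0 r (Y : 'M[R]_r) : minor_defect Y = 0 ->
  forall i j, Y i i * Y j j = Y i j ^+ 2.
Proof.
move=> /eqP; rewrite psumr_eq0 => [/allP Y0 i j|i _]; last first.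
  by rewrite sumr_ge0// => j _; rewrite sqr_ge0.
have := Y0 i (mem_index_enum i); rewrite psumr_eq0 => [/allP|k _]; last exact: sqr_ge0.
by move=> /(_ j (mem_index_enum j)); rewrite sqrf_eq0 subr_eq0 => /eqP.
Qed.

Lemma rank_one_minor_defect r (Y : 'M[R]_r) : Y^T = Y -> \rank Y = 1%N ->
  minor_defect Y = 0.
Proof.
move=> sY rk; apply: big1 => i _; apply: big1 => j _.
apply/eqP; rewrite sqrf_eq0 expr2 subr_eq0; apply/eqP.
rewrite [X in _ = X * _](_ : _ = Y j i); last by rewrite -{1}sY mxE.
have := mulmx_base Y; move: (col_base Y) (row_base Y); rewrite rk => c b <-.
rewrite !mxE !big_ord1; ring.
Qed.

(** The vector is the square root of the diagonal; nonnegative entries leave no choice of sign in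
    [Y i j ^+ 2 = Y i i * Y j j]. *)
Lemma minor_defect_rank1 r (Y : 'M[R]_r) : dnn_feasible Y -> minor_defect Y = 0 ->
  exists2 s : 'cV[R]_r, simplex r s & Y = s *m s^T.
Proof.
move=> [Y1 [pY Y0]] /minor_defect_eq0 mY.
pose s : 'cV[R]_r := \col_i Num.sqrt (Y i i).
have YE : Y = s *m s^T.
  apply/matrixP => i j; rewrite !mxE big_ord1 !mxE -sqrtrM ?Y0//.
  by rewrite mY sqrtr_sqr ger0_norm.
have s0 i : 0 <= s i 0 by rewrite mxE sqrtr_ge0.
exists s => //; split=> //.
move: Y1; rewrite YE frob_ones_rank1 => /eqP.
by rewrite sqrp_eq1 ?vecsum_ge0// => /eqP.
Qed.

(* Two distinct rank one optimizers would have a midpoint of rank two. *)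
Lemma unique_rank_oneP n (Z : 'M[R]_n.+1) : unique_rank_one_optimizer Z <->
  forall Y, dnn_optimizer Z Y -> minor_defect Y = 0.
Proof.
split=> [[Y [oY uY rY]] Y' oY'|mZ].
  by rewrite (uY _ oY') rank_one_minor_defect//; exact: oY.1.2.1.1.
have [Y oY _] := dnn_value_attained Z (ltn0Sn n).
exists Y; split=> // [Y' oY'|]; last first.
  have [s ss YE] := minor_defect_rank1 oY.1 (mZ _ oY).
  apply/eqP; rewrite eqn_leq {1}YE mulmx_max_rank lt0n mxrank_eq0.
  apply: contra_neq (oner_neq0 R) => Y0.
  by rewrite -oY.1.1 Y0 -(scale0r 0) frobZr mul0r.
have [s [s0 s1] YE] := minor_defect_rank1 oY.1 (mZ _ oY).
have [t [t0 t1] Y'E] := minor_defect_rank1 oY'.1 (mZ _ oY').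
pose W := 2^-1 *: (Y + Y').
have fW (A : 'M[R]_n.+1) : frob A W = (frob A Y + frob A Y') / 2.
  by rewrite frobZr mulrC /frob mulmxDr linearD.
have oW : dnn_optimizer Z W.
  split.
    split; first by rewrite fW oY.1.1 oY'.1.1; lra.
    split; last first.
      move=> i j; rewrite !mxE; have := oY.1.2.2 i j; have := oY'.1.2.2 i j; lra.
    split; first by rewrite linearZ linearD /= oY.1.2.1.1 oY'.1.2.1.1.
    move=> x; rewrite quadform_frob fW -!quadform_frob.
    have := oY.1.2.1.2 x; have := oY'.1.2.1.2 x; lra.
  move=> V fV; rewrite fW; have := oY.2 _ fV; have := oY'.2 _ fV; lra.
have WE i j : W i j = (s i 0 * s j 0 + t i 0 * t j 0) / 2.
  by rewrite !mxE YE Y'E !mxE !big_ord1 !mxE; lra.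
(* Lagrange's identity: up to the factor 4, the minor of the midpoint is the square of
   [s i 0 * t j 0 - s j 0 * t i 0]. Proportional vectors with sum one are equal. *)
have st i j : s i 0 * t j 0 = s j 0 * t i 0.
  have := minor_defect_eq0 (mZ _ oW) i j; rewrite !WE => E.
  apply/eqP; rewrite -subr_eq0 -sqrf_eq0; move/eqP: E; rewrite -subr_eq0 => /eqP E.
  by apply/eqP; rewrite -[RHS](mulr0 4) -E; field.
suff ts : t = s by rewrite Y'E ts -YE.
apply/matrixP => i j; rewrite (ord1 j) -[LHS]mul1r -s1 -[RHS]mulr1 -t1 !vecsumE.
by rewrite mulr_suml mulr_sumr; apply: eq_bigr => k _; rewrite -st.
Qed.

End RankOneDefect.

Section Compactness.
Variables (R : realType) (r : nat).
Let N := (r.+1 * r.+1)%N.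
Let mx (v : 'rV[R]_N) : 'M[R]_r.+1 := vec_mx v.

Let entry_continuous i j : continuous (fun v => mx v i j).
Proof.
rewrite (_ : (fun v => mx v i j) = fun v => v 0 (mxvec_index i j)).
  exact: coord_continuous.
by apply/funext => v; rewrite mxE.
Qed.

Lemma frob_vec_continuous (A : 'M[R]_r.+1) : continuous (fun v => frob A (mx v)).
Proof.
rewrite (_ : (fun v => _) = fun v => \sum_i \sum_j A i j * mx v i j); last first.
  by apply/funext => v; rewrite frobE.
apply: Defs.sum_continuous => i; apply: Defs.sum_continuous => j.
apply: Defs.mul_continuous; [exact: cst_continuous|exact: entry_continuous].
Qed.

Lemma minor_defect_vec_continuous : continuous (fun v => minor_defect (mx v)).
Proof.
apply: Defs.sum_continuous => i; apply: Defs.sum_continuous => j.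
have cm : continuous (fun v => mx v i i * mx v j j - mx v i j ^+ 2).
  have c1 := Defs.mul_continuous (@entry_continuous i i) (@entry_continuous j j).
  have c2 := Defs.mul_continuous (@entry_continuous i j) (@entry_continuous i j).
  by move=> v; exact: (@continuousB R R^o _ _ _ v (@c1 v) (@c2 v)).
exact: (Defs.mul_continuous cm cm).
Qed.

Lemma closed_eqf (T : topologicalType) (f g : T -> R) :
  continuous f -> continuous g -> closed [set t | f t = g t].
Proof.
move=> cf cg; rewrite (_ : [set t | f t = g t] =
    [set t | f t <= g t] `&` [set t | g t <= f t]).
  by apply: closedI; exact: le_closed.
apply/seteqP; split=> t /= => [->//|[fg gf]].
by apply/eqP; rewrite eq_le fg.
Qed.

Lemma compact_dnn_feasible (c : R) :
  compact [set v | dnn_feasible (mx v) /\ c <= minor_defect (mx v)].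
Proof.
have box : compact [set v : 'rV[R]_N | forall i, `[0, 1]%classic (v ord0 i)].
  by apply: (@rV_compact R _ (fun=> `[0, 1]%classic)) => _; exact: segment_compact.
apply: (subclosed_compact _ box); last first.
  move=> v [[v1 [_ v0]] _] k /=; rewrite in_itv /=.
  case/mxvec_indexP: k => i j; have vE : v ord0 (mxvec_index i j) = mx v i j.
    by rewrite mxE.
  rewrite vE v0 -v1 frobE (bigD1 i)//= (bigD1 j)//= [ones _ _ _ _]mxE mul1r.
  rewrite -addrA lerDl.
  have v0' k l : 0 <= ones r.+1 r.+1 k l * mx v k l by rewrite [ones _ _ _ _]mxE mul1r.
  by apply: addr_ge0; apply: sumr_ge0 => k _ //; exact: sumr_ge0.
rewrite (_ : [set v | _] = [set v | frob (ones r.+1 r.+1) (mx v) = 1] `&`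
    [set v | forall ij, mx v ij.1 ij.2 = mx v ij.2 ij.1] `&`
    [set v | forall x, 0 <= quadform (mx v) x] `&`
    [set v | forall ij, 0 <= mx v ij.1 ij.2] `&`
    [set v | c <= minor_defect (mx v)]).
  apply: closedI; first apply: closedI; first apply: closedI; first apply: closedI.
  - apply: closed_eqf; [exact: frob_vec_continuous|exact: cst_continuous].
  - by apply: forall_closed => ij; exact: closed_eqf.
  - apply: forall_closed => x; apply: le_closed; first exact: cst_continuous.
    rewrite (_ : (fun v => _) = fun v => frob (x *m x^T) (mx v)).
      exact: frob_vec_continuous.
    by apply/funext => v; rewrite quadform_frob.
  - by apply: forall_closed => ij; apply: le_closed; [exact: cst_continuous|].
  - apply: le_closed; [exact: cst_continuous|exact: minor_defect_vec_continuous].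
apply/seteqP; split=> v /=.
  move=> [[v1 [[sv pv] v0]] cv]; split=> //; split; last by case.
  by split=> //; split=> // -[i j] /=; rewrite -{1}sv mxE.
move=> [[[[v1 sv] pv] v0] cv]; split=> //; split=> //; split; last first.
  by move=> i j; exact: (v0 (i, j)).
by split=> //; apply/matrixP => i j; rewrite mxE -(sv (i, j)).
Qed.

End Compactness.

Section MeasurabilityOfUniqueness.
Context d (T : measurableType d) (R : realType) (n : nat).
Variable Q : T -> 'M[R]_n.+1.
Hypothesis mQ : forall i j, measurable_fun setT (fun w => Q w i j).

(** Mass one makes the objective Lipschitz in the data, uniformly over feasible [Y]. *)
Lemma frob_dist_le (Y A B : 'M[R]_n.+1) e : dnn_feasible Y ->
  (forall i j, `|A i j - B i j| <= e) -> frob A Y <= frob B Y + e.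
Proof.
move=> [Y1 [_ Y0]] AB; rewrite -lerBlDl -[leRHS]mulr1 -Y1 !frobE mulr_sumr -sumrB.
apply: ler_sum => i _; rewrite mulr_sumr -sumrB; apply: ler_sum => j _.
rewrite mxE mul1r -mulrBl ler_wpM2r//.
by apply: le_trans (AB i j); exact: ler_norm.
Qed.

Lemma measurable_box (B : 'M[R]_n.+1) (e : R) :
  measurable [set w | forall i j, `|Q w i j - B i j| < e].
Proof.
rewrite (_ : [set w | _] = \bigcap_(ij in [set: 'I_n.+1 * 'I_n.+1])
    ((fun w => `|Q w ij.1 ij.2 - B ij.1 ij.2| < e) @^-1` [set true])); last first.
  apply/seteqP; split=> w /= h; first by move=> [i j] _ /=; rewrite h.
  by move=> i j; have := h (i, j) I.
apply: fin_bigcap_measurable => // -[i j] _ /=.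
rewrite -[X in measurable X]setTI.
have mf : measurable_fun setT (fun w => `|Q w i j - B i j| < e).
  apply: measurable_fun_ltr => //.
  apply: measurableT_comp => //.
  by apply: measurable_funB.
exact: mf.
Qed.

(** [S] may be uncountable, but the condition is open in the data uniformly in [Y], so it is a
    countable union of boxes with rational center and radius. *)
Lemma measurable_sublevel (S : set 'M[R]_n.+1) (a : R) :
  S `<=` @dnn_feasible R n.+1 ->
  measurable [set w | exists2 Y, S Y & frob (Q w) Y < a].
Proof.
move=> Sf; pose q (p : 'M[rat]_n.+1 * rat) : 'M[R]_n.+1 := map_mx ratr p.1.
rewrite (_ : [set w | _] = \bigcup_(p in [set: 'M[rat]_n.+1 * rat])
  [set w | (exists2 Y, S Y & frob (q p) Y + ratr p.2 < a) /\
           forall i j, `|Q w i j - q p i j| < ratr p.2]).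
  apply: countable_bigcupT_measurable; first exact: countableP.
  move=> p; have [Sp|Sp] := pselect (exists2 Y, S Y & frob (q p) Y + ratr p.2 < a).
    rewrite (_ : [set w | _] = [set w | forall i j, `|Q w i j - q p i j| < ratr p.2]).
      exact: measurable_box.
    by apply/seteqP; split=> w //= [].
  rewrite (_ : [set w | _] = set0); first exact: measurable0.
  by apply/seteqP; split=> w //= [].
apply/seteqP; split=> w /=.
  move=> [Y SY Ya].
  (* Half of the gap, because the radius is spent twice: in passing from [Q w] to the rational
     center, and in the margin required there. *)
  have e0 : 0 < (a - frob (Q w) Y) / 2 by rewrite divr_gt0// subr_gt0.
  have [e] := rat_in_itvoo e0; rewrite in_itv /= => /andP[e1 e2].
  have near i j : exists p : rat, `|Q w i j - ratr p| < ratr e.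
    have h : Q w i j - ratr e < Q w i j by rewrite ltrBlDr ltrDl.
    have [p] := rat_in_itvoo h; rewrite in_itv /= => /andP[p1 p2].
    by exists p; rewrite ger0_norm ?subr_ge0 ?ltW// ltrBlDr -ltrBlDl.
  have [p pP] := choice (fun ij : 'I_n.+1 * 'I_n.+1 => near ij.1 ij.2).
  exists (\matrix_(i, j) p (i, j), e) => //=.
  have qw i j : `|Q w i j - q (\matrix_(i, j) p (i, j), e) i j| < ratr e.
    by rewrite !mxE; exact: (pP (i, j)).
  split=> //; exists Y => //.
  apply: (@le_lt_trans _ _ (frob (Q w) Y + ratr e + ratr e)); last first.
    by rewrite /= in e2 *; lra.
  rewrite lerD2r; apply: frob_dist_le; first exact: Sf.
  by move=> i j; rewrite distrC ltW.
move=> [p _ [[Y SY Ya] qw]]; exists Y => //; apply: le_lt_trans Ya.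
apply: frob_dist_le; first exact: Sf.
by move=> i j; rewrite ltW.
Qed.

(** For each [k] the rational [a] lies above the optimal value and not above any value on [S k]. The
    strict gap comes from an attained minimum over the compact [S k]; conversely every positive
    defect exceeds some 1/(k+1). *)
Lemma measurable_unique_rank_one :
  measurable [set w | unique_rank_one_optimizer (Q w)].
Proof.
pose S k := [set Y : 'M[R]_n.+1 | dnn_feasible Y /\ k.+1%:R^-1 <= minor_defect Y].
pose sub S a := [set w | exists2 Y : 'M[R]_n.+1, S Y & frob (Q w) Y < a].
rewrite (_ : [set w | _] = \bigcap_k \bigcup_(a : rat)
    (sub (@dnn_feasible R n.+1) (ratr a) `\` sub (S k) (ratr a))).
  apply: bigcapT_measurable => k; apply: bigcupT_measurable_rat => a.
  by apply: measurableD; apply: measurable_sublevel => // Y [].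
apply/seteqP; split=> w /=.
  move=> /unique_rank_oneP opt0 k _.
  have [Y0 oY0 _] := dnn_value_attained (Q w) (ltn0Sn n).
  pose K := [set v : 'rV[R]_(n.+1 * n.+1) | dnn_feasible (vec_mx v : 'M[R]_n.+1) /\
     k.+1%:R^-1 <= minor_defect (vec_mx v : 'M[R]_n.+1)].
  have cK : compact K := @compact_dnn_feasible R n (k.+1%:R^-1).
  have SK Y : S k Y -> K (mxvec Y) by rewrite /K /= mxvecK.
  have [K0|K0] := pselect (K !=set0); last first.
    have [a] := rat_in_itvoo (ltr_pwDr ltr01 (lexx (frob (Q w) Y0))).
    rewrite in_itv /= => /andP[a1 _]; exists a => //; split; first by exists Y0 => //; exact: oY0.1.
    by move=> [Y SY _]; apply: K0; exists (mxvec Y); exact: SK.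
  have [v Kv vmin] := compact_EVT_min K0 cK
    (continuous_subspaceT (@frob_vec_continuous R n (Q w))).
  rewrite inE in Kv.
  have gap : frob (Q w) Y0 < frob (Q w) (vec_mx v).
    rewrite ltNge; apply/negP => le0.
    have /opt0 mv : dnn_optimizer (Q w) (vec_mx v).
      by split=> [|Y fY]; [exact: Kv.1|exact: le_trans (oY0.2 _ fY)].
    by move: Kv.2; rewrite mv leNgt invr_gt0 ltr0n.
  have [a] := rat_in_itvoo gap; rewrite in_itv /= => /andP[a1 a2].
  exists a => //; split; first by exists Y0 => //; exact: oY0.1.
  move=> [Y SY Ya]; have := vmin (mxvec Y) (mem_set (SK _ SY)); rewrite mxvecK leNgt.
  by rewrite (lt_trans Ya a2).
move=> gap; apply/unique_rank_oneP => Y oY; apply/eqP/negPn/negP => mY.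
have mY0 : 0 < minor_defect Y.
  rewrite lt_neqAle eq_sym mY; apply: sumr_ge0 => i _; apply: sumr_ge0 => j _.
  exact: sqr_ge0.
have [k kY] : exists k, k.+1%:R^-1 <= minor_defect Y.
  exists (Num.bound (minor_defect Y)^-1); rewrite invf_ple ?posrE//.
  apply: ltW; apply: (@lt_trans _ _ (Num.bound (minor_defect Y)^-1)%:R).
    by apply: archi_boundP; rewrite invr_ge0 ltW.
  by rewrite ltr_nat.
have [a _ [[Y0 fY0 Y0a] Sa]] := gap k I.
apply: Sa; exists Y; first by split=> //; exact: oY.1.
by apply: le_lt_trans Y0a; exact: oY.2.
Qed.

End MeasurabilityOfUniqueness.

(** * Large components *)

Section FiniteSubadditivity.
Context d (T : measurableType d) (R : realType) (mu : {measure set T -> \bar R}).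
Local Open Scope ereal_scope.

Lemma measure_fin_bigcup_le (I : finType) (F : I -> set T) :
  (forall i, measurable (F i)) -> mu (\bigcup_i F i) <= \sum_i mu (F i).
Proof.
move=> mF.
have seqF (s : seq I) : measurable (\bigcup_(i in [set` s]) F i) /\
    mu (\bigcup_(i in [set` s]) F i) <= \sum_(i <- s) mu (F i).
  rewrite bigcup_seq; elim: s => [|i s [mU leU]].
    by rewrite !big_nil measure0; split; [exact: measurable0|].
  rewrite !big_cons; split; first exact: measurableU.
  by apply: le_trans (measureU2 _ _ _) _ => //; rewrite leeD2l.
have [_] := seqF (index_enum I); rewrite (_ : [set` _] = setT)//.
by apply/seteqP; split => // i _ /=; exact: mem_index_enum.
Qed.

End FiniteSubadditivity.

(** * Sublevel sets of a distribution function *)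

Section CdfLevel.
Context d (T : measurableType d) (R : realType) (P : probability T R).
Variables (X : {RV P >-> R}) (F : R -> R).
Hypothesis XF : forall x, cdf X x = (F x)%:E.

Lemma cdf_homo x y : x <= y -> F x <= F y.
Proof. by move=> xy; rewrite -lee_fin -!XF cdf_nondecreasing. Qed.

Lemma cdf_bounds x : 0 <= F x <= 1.
Proof. by rewrite -!lee_fin -XF cdf_ge0 cdf_le1. Qed.

Lemma measurable_cdf_fin : measurable_fun setT F.
Proof.
rewrite (_ : F = fine \o cdf X); last by apply/funext => x /=; rewrite XF.
by apply: measurableT_comp => //; exact: cdf_measurable.
Qed.

Lemma measurable_cdf_lt t : measurable [set x | F x < t].
Proof.
rewrite -[X in measurable X]setTI.
have : measurable_fun setT (fun x => F x < t).
  by apply: measurable_fun_ltr => //; exact: measurable_cdf_fin.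
by move=> /(_ measurableT [set true] I).
Qed.

Lemma cdf_le_seq t (x_ : nat -> R) (A : set R) : measurable A ->
  {homo x_ : k l / (k <= l)%N >-> k <= l} -> (forall k, F (x_ k) <= t) ->
  A `<=` \bigcup_k `]-oo, x_ k]%classic -> (P (X @^-1` A) <= t%:E)%E.
Proof.
move=> mA ndx Fx Ax.
pose U k := X @^-1` `]-oo, x_ k]%classic.
have mU k : measurable (U k) by exact: measurable_funPTI.
have PU k : P (U k) = (F (x_ k))%:E by rewrite -XF.
have cU : P \o U @ \oo --> P (\bigcup_k U k).
  apply: nondecreasing_cvg_mu => //; first exact: bigcupT_measurable.
  move=> k l kl; apply/subsetPset => w; rewrite /U /= !in_itv /= => /le_trans; apply.
  exact: ndx.
apply: (@le_trans _ _ (P (\bigcup_k U k))).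
  apply: le_measure; rewrite ?inE; [exact: measurable_funPTI|exact: bigcupT_measurable|].
  by move=> w /Ax[k _ ?]; exists k.
rewrite -(cvg_lim _ cU)//; apply: lime_le; first by apply/cvg_ex; eexists; exact: cU.
by apply: nearW => k /=; rewrite PU lee_fin.
Qed.

(** The set where [F] is below [t] is a down-set: empty, the whole line, or a half line with or
    without its endpoint. Unless empty, it is exhausted by half lines ending at points where [F] is
    at most [t]. *)
Lemma probability_cdf_lt (t : R) : 0 <= t ->
  (P [set w | (F (X w) < t)%R] <= t%:E)%E.
Proof.
move=> t0; pose D := [set x | F x < t].
have mD : measurable D by exact: measurable_cdf_lt.
have -> : [set w | F (X w) < t] = X @^-1` D by [].
have [[x0 Dx0]|D0] := pselect (D !=set0); last first.
  by rewrite (_ : D = set0) ?preimage_set0 ?measure0//; apply: contrapT => /eqP/set0P.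
have Ddown x y : D y -> x <= y -> D x.
  by move=> Dy xy; apply: le_lt_trans Dy; exact: cdf_homo.
have [ubD|ubD] := pselect (has_ubound D); last first.
  apply: (cdf_le_seq (x_ := fun k => k%:R)) => //.
  - by move=> k l kl; rewrite ler_nat.
  - move=> k; have [y] : exists2 y, D y & k%:R < y.
      apply: contrapT => h; apply: ubD; exists k%:R => y Dy.
      by rewrite leNgt; apply/negP => ky; apply: h; exists y.
    by move=> Dy ky; apply: ltW; exact: Ddown Dy (ltW ky).
  - move=> x _; exists (Num.bound `|x|) => //=; rewrite in_itv /=.
    by apply: ltW; apply: le_lt_trans (ler_norm x) _; exact: archi_boundP.
have supD : has_sup D by split=> //; exists x0.
have [Ds|Ds] := pselect (D (sup D)).
  apply: (cdf_le_seq (x_ := fun=> sup D)) => //.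
    by move=> k; exact: ltW Ds.
  move=> x Dx; exists 0%N => //=; rewrite in_itv /=.
  exact: sup_upper_bound.
apply: (cdf_le_seq (x_ := fun k => sup D - k.+1%:R^-1)) => //.
- by move=> k l kl; rewrite lerB// lef_pV2 ?posrE// ler_nat.
- move=> k; have k0 : 0 < k.+1%:R^-1 :> R by rewrite invr_gt0.
  have [y Dy sy] := sup_adherent k0 supD.
  by apply: ltW; exact: Ddown Dy (ltW sy).
- move=> x Dx.
  have xs : x < sup D.
    rewrite lt_neqAle sup_upper_bound// andbT.
    by apply/eqP => E; apply: Ds; rewrite -E.
  exists (Num.bound (sup D - x)^-1) => //=; rewrite in_itv /= lerBrDr -lerBrDl.
  have sx0 : 0 < sup D - x by rewrite subr_gt0.
  rewrite invf_ple ?posrE// ltW//.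
  apply: lt_trans (archi_boundP _) _; first by rewrite invr_ge0 ltW.
  by rewrite ltr_nat.
Qed.

End CdfLevel.

Section IndependenceProduct.
Context d (T : measurableType d) (R : realType) (P : probability T R).
Variables (I : finType) (X : I -> T -> R).
Hypothesis indep : mutually_independent P X.

Lemma independent_disjoint (J K : {set I}) (A : I -> set R) :
  fintype.disjoint (mem J) (mem K) -> (forall i, measurable (A i)) ->
  P ((\bigcap_(i in [set` J]) X i @^-1` A i) `&`
     (\bigcap_(i in [set` K]) X i @^-1` A i)) =
  (P (\bigcap_(i in [set` J]) X i @^-1` A i) *
   P (\bigcap_(i in [set` K]) X i @^-1` A i))%E.
Proof.
move=> JK mA; rewrite !indep// -bigcap_setU.
rewrite (_ : [set` J] `|` [set` K] = [set` (J :|: K)%SET]); last first.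
  by apply/seteqP; split=> i /=; rewrite inE => /orP.
by rewrite indep// -bigU//; apply: eq_bigl => i; rewrite !inE.
Qed.

End IndependenceProduct.

Definition upper_index (n : nat) := {ij : 'I_n.+1 * 'I_n.+1 | (ij.1 <= ij.2)%N}.

(** * Four off-diagonal entries below the diagonal minimum *)

Section EdgeBound.
Context d (T : measurableType d) (R : realType) (P : probability T R) (n : nat).
Variables (Q : T -> 'M[R]_n.+1) (F : R -> R).
Hypothesis mQ : forall i j, measurable_fun setT (fun w => Q w i j).
Let X (p : upper_index n) (w : T) : R := Q w (val p).1 (val p).2.
Hypothesis indep : mutually_independent P X.
Hypothesis F_homo : {homo F : x y / x <= y}.
Hypothesis F_bounds : forall x, 0 <= F x <= 1.
Hypothesis mF : measurable_fun setT F.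

Definition offdiag (p : upper_index n) : bool := (val p).1 != (val p).2.

Hypothesis F_off : forall p (t : R), offdiag p -> 0 <= t ->
  (P [set w | (F (X p w) < t)%R] <= t%:E)%E.

Lemma measurable_diag_min : measurable_fun setT (fun w => diag_min (Q w)).
Proof.
rewrite /diag_min /index_enum; elim: (Finite.enum _) => [|i s IH].
  by under eq_fun do rewrite big_nil; exact: mQ.
by under eq_fun do rewrite big_cons; exact: measurable_minr.
Qed.

Lemma measurable_lt_set (f g : T -> R) : measurable_fun setT f ->
  measurable_fun setT g -> measurable [set w | f w < g w].
Proof.
move=> mf mg; have := measurable_fun_ltr mf mg.
by move=> /(_ measurableT [set true] I); rewrite setTI.
Qed.

Let G w := F (diag_min (Q w)).

Let mG : measurable_fun setT G.
Proof. by apply: measurableT_comp; last exact: measurable_diag_min. Qed.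

Let diagset : {set upper_index n} := [set p | ~~ offdiag p]%SET.
Let B s := [set w | s <= G w].
Let O (E : {set upper_index n}) t := [set w | forall p, p \in E -> F (X p w) < t].
(** A single family of sets for both kinds of coordinates, so that [B s] and [O E t] are cylinders
    over disjoint index sets and independence applies. *)
Let level s t p : set R := if offdiag p then [set x | F x < t] else [set x | s <= F x].

Let mlevel s t p : measurable (level s t p).
Proof.
rewrite /level; case: ifP => _.
  have := measurable_fun_ltr mF (@measurable_cst _ _ _ _ setT t).
  by move=> /(_ measurableT [set true] I); rewrite setTI.
have := measurable_fun_ler (@measurable_cst _ _ _ _ setT s) mF.
by move=> /(_ measurableT [set true] I); rewrite setTI.
Qed.

(** [F] is monotone and the minimum is attained, so the bound at the minimum is the bound at every
    diagonal entry. *)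
Let BE s t : B s = \bigcap_(p in [set` diagset]) X p @^-1` level s t p.
Proof.
apply/seteqP; split=> w.
  move=> /= sG p /=; rewrite inE => pd; rewrite /level (negbTE pd) /=.
  apply: le_trans sG _; apply: F_homo.
  by move: pd; rewrite /X /offdiag negbK => /eqP ->; exact: diag_min_le.
move=> h; rewrite /B /= /G; have [i ->] := diag_min_attained (Q w).
pose p : upper_index n := exist _ (i, i) (leqnn i).
have pd : p \in diagset by rewrite inE /offdiag /= eqxx.
by have := h p pd; rewrite /level /offdiag /= eqxx.
Qed.

Let OE (E : {set upper_index n}) s t : (forall p, p \in E -> offdiag p) ->
  O E t = \bigcap_(p in [set` E]) X p @^-1` level s t p.
Proof.
move=> Eoff; apply/seteqP; split=> w h p pE.
  by rewrite /level /= Eoff//; exact: h.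
by have := h p pE; rewrite /level /= Eoff.
Qed.

Let mB s : measurable (B s).
Proof.
have := measurable_fun_ler (@measurable_cst _ _ _ _ setT s) mG.
by move=> /(_ measurableT [set true] I); rewrite setTI.
Qed.

Let mX p : measurable_fun setT (X p).
Proof. exact: mQ. Qed.

Let mO (E : {set upper_index n}) (t : R) : (forall p, p \in E -> offdiag p) -> measurable (O E t).
Proof.
move=> Eoff; rewrite (OE 0)//; apply: fin_bigcap_measurable => // p pE.
by rewrite -[X in measurable X]setTI; apply: mX => //; exact: mlevel.
Qed.

Let indepBO (E : {set upper_index n}) (s t : R) : (forall p, p \in E -> offdiag p) ->
  P (B s `&` O E t) = (P (B s) * P (O E t))%E.
Proof.
move=> Eoff; rewrite (BE s t) (OE s)//; apply: independent_disjoint => //.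
rewrite disjoint_subset; apply/fintype.subsetP => p; rewrite !inE.
by apply: contra => /Eoff.
Qed.

Let PO_le (E : {set upper_index n}) (t : R) : (forall p, p \in E -> offdiag p) -> 0 <= t ->
  (P (O E t) <= (t ^+ #|E|)%:E)%E.
Proof.
move=> Eoff t0; rewrite (OE 0)// indep//.
pose r p := fine (P (X p @^-1` level 0 t p)).
have rE p : P (X p @^-1` level 0 t p) = (r p)%:E.
  by rewrite fineK// fin_num_measure// -[X in measurable X]setTI; apply: mX.
under eq_bigr do rewrite rE.
rewrite prodEFin lee_fin -prodr_const; apply: ler_prod => p pE.
rewrite fine_ge0//= -lee_fin -rE /level Eoff//.
by apply: F_off => //; exact: Eoff.
Qed.

Let indepAO (E : {set upper_index n}) (a b t : R) : (forall p, p \in E -> offdiag p) -> a <= b ->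
  P ((B a `\` B b) `&` O E t) = (P (B a `\` B b) * P (O E t))%E.
Proof.
move=> Eoff ab; have sub : B b `<=` B a by move=> w; exact: le_trans.
have mOE := mO t Eoff.
have -> : (B a `\` B b) `&` O E t = (B a `&` O E t) `\` (B b `&` O E t).
  apply/seteqP; split=> w /=; first by move=> [[Ba Bb] Ow]; split=> // -[].
  by move=> [[Ba Ow] nb]; split=> //; split=> // Bb; apply: nb.
rewrite !measureD//; first last.
- by rewrite -ge0_fin_numE// fin_num_measure//; exact: measurableI.
- exact: measurableI.
- exact: measurableI.
- by rewrite -ge0_fin_numE// fin_num_measure.
rewrite [B a `&` B b]setIidr// [_ `&` (B b `&` _)]setIidr; last first.
  by apply: setSI.
transitivity (P (B a) * P (O E t) - P (B b) * P (O E t))%E.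
  by congr (_ - _)%E; exact: indepBO.
rewrite muleBl ?fin_num_measure//.
by rewrite fin_num_adde_defl// fin_numN fin_num_measure.
Qed.

Let below (E : {set upper_index n}) := [set w | forall p, p \in E -> X p w < diag_min (Q w)].

Let mbelow (E : {set upper_index n}) : measurable (below E).
Proof.
rewrite (_ : below E = \bigcap_(p in [set` E]) [set w | X p w < diag_min (Q w)]).
  by apply: fin_bigcap_measurable => // p _; apply: measurable_lt_set;
    [exact: mX|exact: measurable_diag_min].
by [].
Qed.

Let pow4_le (a b : R) : 0 <= a -> 0 <= b -> (a + b) ^+ 4 <= 8 * (a ^+ 4 + b ^+ 4).
Proof.
move=> a0 b0; rewrite -subr_ge0.
have -> : 8 * (a ^+ 4 + b ^+ 4) - (a + b) ^+ 4 =
  (a - b) ^+ 2 * (7 * a ^+ 2 + 10 * a * b + 7 * b ^+ 2) by ring.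
by rewrite mulr_ge0 ?sqr_ge0// !addr_ge0 ?mulr_ge0 ?sqr_ge0// ler0n.
Qed.

(* Slice according to the value of F(m_n) at scale 1/N. On a slice, the events
   X p < m_n only depend on off-diagonal entries. *)
Let below_slices (E : {set upper_index n}) (N : nat) :
  (forall p, p \in E -> offdiag p) -> #|E| = 4%N -> (0 < N)%N ->
  (P (below E) <= 8%:E * ('E_P[fun w => (G w ^+ 4)%R] + ((N%:R^-1) ^+ 4)%:E))%E.
Proof.
move=> Eoff E4 N0; have N0R : 0 < N%:R :> R by rewrite ltr0n.
pose a k : R := k%:R / N%:R.
have a0 k : 0 <= a k by rewrite divr_ge0.
have aS k : a k.+1 = a k + N%:R^-1 by rewrite /a -natr1 mulrDl mul1r.
have aS_le k : a k <= a k.+1 by rewrite aS lerDl invr_ge0 ltW.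
pose A k := B (a k) `\` B (a k.+1).
have mA k : measurable (A k) by exact: measurableD.
have AE k w : A k w -> Num.truncn (G w * N%:R) = k.
  move=> [/= Ba /negP]; rewrite -ltNge => Bb; apply: truncn_def.
  by rewrite -ler_pdivrMr// Ba -ltr_pdivlMr.
have G0 w : 0 <= G w by have /andP[] := F_bounds (diag_min (Q w)).
have G1 w : G w <= 1 by have /andP[] := F_bounds (diag_min (Q w)).
have Acover w : A (Num.truncn (G w * N%:R)) w.
  have /truncn_itv/andP[h1 h2] : 0 <= G w * N%:R by rewrite mulr_ge0.
  split; first by rewrite /B /= ler_pdivrMr.
  by apply/negP; rewrite -ltNge ltr_pdivlMr.
(* There are [N.+1] slices rather than [N], because [G w] may equal 1. *)
have trunc_le w : (Num.truncn (G w * N%:R) < N.+1)%N.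
  by rewrite ltnS truncn_le_nat (@le_lt_trans _ _ N%:R) ?ltr_nat// ler_piMl.
pose c k : R := 8 * (a k ^+ 4 + N%:R^-1 ^+ 4).
have c0 k : 0 <= c k by rewrite mulr_ge0// addr_ge0// exprn_ge0// invr_ge0 ltW.
have slice k : (P (A k `&` O E (a k.+1)) <= (c k)%:E * P (A k))%E.
  rewrite indepAO// muleC lee_wpmul2r//; apply: (le_trans (PO_le _ _)) => //.
  by rewrite E4 lee_fin aS pow4_le// invr_ge0 ltW.
have mAO k : measurable (A k `&` O E (a k.+1)) by apply: measurableI => //; exact: mO.
apply: (@le_trans _ _ (\sum_(k < N.+1) (c k)%:E * P (A k))%E).
  apply: (@le_trans _ _ (\sum_(k < N.+1) P (A k `&` O E (a k.+1)))%E); last first.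
    by apply: lee_sum => k _; exact: slice.
  apply: (@le_trans _ _ (P (\bigcup_(k in [set: 'I_N.+1]) (A k `&` O E (a k.+1))))).
    apply: le_measure; rewrite ?inE; first exact: mbelow.
      by apply: fin_bigcup_measurable => [|k _]; [exact: finite_finset|exact: mAO].
    (* From [X p w < diag_min (Q w)] monotonicity gives only a weak inequality for [F]; strictness
       comes from the open upper end of the slice. *)
    move=> w wE; exists (Ordinal (trunc_le w)) => //=; split; first exact: Acover.
    move=> p pE; have [_ /negP] := Acover w; rewrite /B /= -ltNge; apply: le_lt_trans.
    by apply: F_homo; apply: ltW; exact: wE.
  exact: (measure_fin_bigcup_le P (F := fun k : 'I_N.+1 => A k `&` O E (a k.+1))).
have mind k : measurable_fun setT (fun w => (\1_(A k) w)%:E : \bar R).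
  by apply/measurable_EFinP; exact: measurable_indic.
have -> : (\sum_(k < N.+1) (c k)%:E * P (A k) =
    \int[P]_w \sum_(k < N.+1) (c k)%:E * (\1_(A k) w)%:E)%E.
  rewrite ge0_integral_sum//; first last.
  - by move=> k w _; rewrite mule_ge0// lee_fin.
  - by move=> k; exact: measurable_funeM.
  apply: eq_bigr => k _; rewrite ge0_integralZl//; last by rewrite lee_fin.
  by rewrite integral_indic// setIT.
have mG4 : measurable_fun setT (fun w => G w ^+ 4) by exact: measurable_funX.
have -> : (8%:E * ('E_P[fun w => (G w ^+ 4)%R] + (N%:R^-1 ^+ 4)%:E) =
    \int[P]_w (8%:E * ((G w ^+ 4)%:E + (N%:R^-1 ^+ 4)%:E)))%E.
  have G40 w : 0 <= G w ^+ 4 by rewrite exprn_ge0.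
  have N40 : 0 <= N%:R^-1 ^+ 4 :> R by rewrite exprn_ge0// invr_ge0 ltW.
  rewrite ge0_integralZl//; last 2 first.
  - by apply: emeasurable_funD => //; exact/measurable_EFinP.
  - by move=> w _; rewrite adde_ge0// lee_fin.
  rewrite ge0_integralD//; last 2 first.
  - by move=> w _; rewrite lee_fin.
  - exact/measurable_EFinP.
  by rewrite integral_cst//= probability_setT mule1 unlock.
apply: ge0_le_integral => //.
- by move=> w _; apply: sume_ge0 => k _; rewrite mule_ge0// lee_fin.
- by apply: emeasurable_sum => k; exact: measurable_funeM.
- apply: measurable_funeM; apply: emeasurable_funD => //; exact/measurable_EFinP.
(* Exactly one slice contains [w], and its lower end is at most [G w]. *)
move=> w _; rewrite (bigD1 (Ordinal (trunc_le w)))//= big1 ?adde0 => [|k kw]; last first.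
  rewrite indicE memNset ?mule0// => /AE E0; move/eqP: kw; apply; apply: val_inj.
  by rewrite /= E0.
rewrite indicE (mem_set (Acover w)) mule1 lee_fin ler_wpM2l// lerD2r.
by apply: lerXn2r; rewrite ?nnegrE//; have [] := Acover w.
Qed.

Lemma probability_below (E : {set upper_index n}) :
  (forall p, p \in E -> offdiag p) -> #|E| = 4%N ->
  (P (below E) <= 8%:E * 'E_P[fun w => (G w ^+ 4)%R])%E.
Proof.
move=> Eoff E4; apply/lee_addgt0Pr => e e0.
have e8 : 0 < e / 8 by rewrite divr_gt0.
(* With [N] at least 1, the error N^-4 is at most 1/N, hence at most [e / 8]. *)
pose N := (Num.bound (e / 8)^-1).+1.
have N1 : 1 <= N%:R :> R by rewrite ler1n.
have Ne : N%:R^-1 <= e / 8.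
  rewrite invf_ple ?posrE// ltW//.
  apply: lt_le_trans (archi_boundP _) _; first by rewrite invr_ge0 ltW.
  by rewrite ler_nat.
apply: (le_trans (below_slices Eoff E4 (ltn0Sn _ : (0 < N)%N))).
rewrite muleDr//; last first.
  apply: ge0_adde_def; rewrite inE ?lee_fin ?exprn_ge0// ?invr_ge0//.
  by apply: expectation_ge0 => w; rewrite exprn_even_ge0.
rewrite leeD2l// lee_fin -ler_pdivlMl// mulrC; apply: le_trans Ne.
by rewrite -[leRHS]expr1 ler_wiXn2l// ?invr_ge0// invf_le1.
Qed.

End EdgeBound.

(** * Trees on five vertices inside a large component *)

Section SpanningTree.
Variables (R : realType) (n : nat).
Implicit Types (Q : 'M[R]_n.+1).

Lemma component_edge_out Q i (S : {set 'I_n.+1}) : Q^T = Q -> i \in S ->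
  (#|S| < #|component Q i|)%N -> exists x y, [/\ x \in S, y \notin S & defect_edge Q x y].
Proof.
move=> sQ iS cS; apply: contrapT => noedge.
have clS : fingraph.closed (defect_edge Q) (mem S).
  apply: intro_closed; first exact/sym_connect_sym/defect_edge_sym.
  move=> x y xy xS; apply: contrapT => /negP yS; apply: noedge.
  by exists x, y.
move: cS; rewrite ltnNge => /negP; apply; apply: subset_leq_card.
apply/fintype.subsetP => j; rewrite inE => ij.
by have := closed_connect clS ij; rewrite /= iS => <-.
Qed.

(** Greedy growth by outgoing edges; [v] lists vertices in order of discovery, so the parent of
    vertex a+1 has index at most a. *)
Lemma component_tree Q i k : Q^T = Q -> (k < #|component Q i|)%N ->
  exists (v : nat -> 'I_n.+1) (p : nat -> nat),
    [/\ v 0%N = i,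
        forall a b, (a <= k)%N -> (b <= k)%N -> v a = v b -> a = b &
        forall a, (a < k)%N -> (p a <= a)%N /\ defect_edge Q (v (p a)) (v a.+1)].
Proof.
move=> sQ; elim: k => [_|k IH kC].
  exists (fun=> i), id; split => // a b; rewrite !leqn0 => /eqP -> /eqP -> //.
have [v [p [v0 vinj vp]]] := IH (ltnW kC).
pose S := [set v (a : 'I_k.+1) | a in 'I_k.+1]%SET.
have vS a : (a <= k)%N -> v a \in S.
  by move=> ak; apply/imsetP; exists (Ordinal (ak : (a < k.+1)%N)).
have iS : i \in S by rewrite -v0 vS.
have cS : #|S| = k.+1.
  rewrite card_imset ?card_ord// => a b /vinj E; apply: val_inj; apply: E.
    by rewrite -ltnS.
  by rewrite -ltnS.
have [|x [y [/imsetP[a _ ->] yS axy]]] := component_edge_out sQ iS; first by rewrite cS.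
exists (fun b => if b == k.+1 then y else v b), (fun b => if b == k then a : nat else p b).
have vy b : (b <= k)%N -> v b != y by move=> bk; apply: contraNneq yS => <-; exact: vS.
split=> //.
  move=> b c; rewrite leq_eqVlt ltnS [(c <= _)%N]leq_eqVlt ltnS.
  case: eqVneq => [->|_] /=; case: eqVneq => [->|_] //=.
  - by move=> _ ck E; move: (vy c ck); rewrite E eqxx.
  - by move=> bk _ E; move: (vy b bk); rewrite E eqxx.
  - exact: vinj.
move=> b; rewrite ltnS eqSS leq_eqVlt; case: eqVneq => [-> _|bk /= bk'].
  by rewrite ltn_eqF// -ltnS; split=> //; rewrite -ltnS.
have [pb eb] := vp b bk'; split=> //.
by rewrite ltn_eqF// (leq_ltn_trans pb)// (ltn_trans bk').
Qed.

Definition edge_index (a b : 'I_n.+1) : upper_index n :=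
  insubd (exist _ (ord0, ord0) (leqnn 0)) (if (a <= b)%N then (a, b) else (b, a)).

Lemma val_edge_index a b :
  val (edge_index a b) = if (a <= b)%N then (a, b) else (b, a).
Proof.
rewrite val_insubd; case: (leqP a b) => [->//|ba] /=.
by rewrite (ltnW ba).
Qed.

(** A tree is coded by its vertex list and parent map, a finite type with (n+1)^5 * 5^4 elements
    over which the union bound runs. *)
Definition tree_edge (v : {ffun 'I_5 -> 'I_n.+1}) (p : {ffun 'I_4 -> 'I_5})
  (j : 'I_4) : upper_index n := edge_index (v (p j)) (v (lift ord0 j)).

Definition valid_tree (v : {ffun 'I_5 -> 'I_n.+1}) (p : {ffun 'I_4 -> 'I_5}) : bool :=
  injectiveb v && [forall j, (p j <= j)%N].

Definition tree_edges v p : {set upper_index n} := [set tree_edge v p j | j in 'I_4]%SET.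

Lemma edge_index_inj a b a' b' : edge_index a b = edge_index a' b' ->
  (b' == a) || (b' == b).
Proof.
move=> /(congr1 val); rewrite !val_edge_index.
by case: ifP => _; case: ifP => _ [-> ->]; rewrite eqxx ?orbT.
Qed.

(* In a valid tree the parent of vertex j+1 has index at most j, so the last
   vertex of an edge identifies it. *)
Lemma tree_edge_inj v p : valid_tree v p -> injective (tree_edge v p).
Proof.
move=> /andP[/injectiveP vinj /forallP pj].
have lt (j l : 'I_4) : (j < l)%N -> tree_edge v p j <> tree_edge v p l.
  move=> jl /edge_index_inj /orP[] /eqP /vinj /(congr1 val) /=.
    by rewrite /bump /= add1n => E; have := pj j; rewrite -E leqNgt (ltn_trans jl).
  by rewrite /bump /= !add1n => -[E]; move: jl; rewrite E ltnn.
move=> j l E; apply: val_inj; apply/eqP; case: ltngtP => // jl.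
  by case: (lt _ _ jl).
by case: (lt _ _ jl).
Qed.

Lemma card_tree_edges v p : valid_tree v p -> #|tree_edges v p| = 4%N.
Proof. by move=> vp; rewrite card_imset ?card_ord//; exact: tree_edge_inj. Qed.

Lemma tree_edges_offdiag v p : valid_tree v p ->
  forall e, e \in tree_edges v p -> offdiag e.
Proof.
move=> /andP[/injectiveP vinj /forallP pj] e /imsetP[j _ ->].
have ne : v (p j) != v (lift ord0 j).
  apply/eqP => /vinj /(congr1 val); rewrite /= /bump /= add1n => E.
  by have := pj j; rewrite E ltnn.
rewrite /offdiag /tree_edge val_edge_index.
by case: ifP => _ //=; rewrite eq_sym.
Qed.

Lemma large_component_tree Q : Q^T = Q -> ~~ (max_component_size Q <= 4)%N ->
  exists v p, valid_tree v p /\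
    forall e, e \in tree_edges v p -> Q (val e).1 (val e).2 < diag_min Q.
Proof.
move=> sQ big; have [C CC] : exists2 C, C \in components Q & (4 < #|C|)%N.
  apply: contrapT => h; move/negP: big; apply; apply/bigmax_leqP => C CC.
  by rewrite leqNgt; apply/negP => C4; apply: h; exists C.
move: CC => /imsetP[i _ ->] C4.
have [v [p [_ vinj vp]]] := component_tree sQ C4.
exists [ffun a : 'I_5 => v a], [ffun j : 'I_4 => inord (p j)]; split.
  apply/andP; split.
    apply/injectiveP => a b; rewrite !ffunE => /vinj E; apply: val_inj.
    by apply: E; rewrite -ltnS.
  apply/forallP => j; rewrite ffunE inordK; first by have [] := vp j (ltn_ord j).
  have [pj _] := vp j (ltn_ord j); apply: leq_ltn_trans pj _.
  by apply: ltn_trans (ltn_ord j) _.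
move=> e /imsetP[j _ ->]; have [pj /andP[_]] := vp j (ltn_ord j).
rewrite shiftedE subr_lt0 => h.
have p5 : (p j < 5)%N by apply: leq_ltn_trans pj _; apply: ltn_trans (ltn_ord j) _.
rewrite /tree_edge val_edge_index !ffunE inordK//= /bump /= add1n.
case: ifP => _ //=.
by rewrite -[Q in ltLHS]sQ mxE.
Qed.

(** Makes events about component sizes finite unions over edge patterns, hence measurable. *)
Lemma max_component_size_edges Q Q' : defect_edge Q =2 defect_edge Q' ->
  max_component_size Q = max_component_size Q'.
Proof.
move=> QQ'; rewrite /max_component_size.
suff -> : components Q = components Q' by [].
apply: eq_imset => i; apply/setP => j; rewrite !inE.
exact: eq_connect.
Qed.

End SpanningTree.

Section LargeComponentBound.
Context d (T : measurableType d) (R : realType) (P : probability T R) (n : nat).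
Variables (Q : T -> 'M[R]_n.+1) (F : R -> R).
Hypothesis symQ : forall w, (Q w)^T = Q w.
Hypothesis mQ : forall i j, measurable_fun setT (fun w => Q w i j).

Lemma measurable_max_component_size k :
  measurable [set w | (max_component_size (Q w) <= k)%N].
Proof.
pose edges w := [ffun ij : 'I_n.+1 * 'I_n.+1 => defect_edge (Q w) ij.1 ij.2].
rewrite (_ : [set w | _] = \bigcup_(b in
    [set b | exists2 w, edges w = b & (max_component_size (Q w) <= k)%N])
    [set w | edges w = b]); last first.
  apply/seteqP; split=> w /=; first by move=> wk; exists (edges w) => //; exists w.
  move=> [b [w' wb w'k] /= wb']; rewrite (@max_component_size_edges _ _ _ (Q w'))//.
  by move=> i j; have /ffunP/(_ (i, j)) := etrans wb' (esym wb); rewrite !ffunE.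
apply: fin_bigcup_measurable => // b _.
rewrite (_ : [set w | _] = \bigcap_(ij in [set: 'I_n.+1 * 'I_n.+1])
   ((fun w => defect_edge (Q w) ij.1 ij.2) @^-1` [set b ij])); last first.
  apply/seteqP; split=> w /= h; first by move=> ij _ /=; rewrite -h ffunE.
  by apply/ffunP => ij; rewrite ffunE; exact: (h ij I).
apply: fin_bigcap_measurable => // -[i j] _ /=.
rewrite -[X in measurable X]setTI.
have : measurable_fun setT (fun w => defect_edge (Q w) i j).
  rewrite /defect_edge; apply: measurable_and => //.
  under eq_fun do rewrite shiftedE.
  apply: measurable_fun_ltr => //; apply: measurable_funB => //.
  exact: measurable_diag_min.
by apply.
Qed.

Let X (p : upper_index n) (w : T) : R := Q w (val p).1 (val p).2.
Hypothesis indep : mutually_independent P X.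
Hypothesis F_homo : {homo F : x y / x <= y}.
Hypothesis F_bounds : forall x, 0 <= F x <= 1.
Hypothesis mF : measurable_fun setT F.
Hypothesis F_off : forall p (t : R), offdiag p -> 0 <= t ->
  (P [set w | (F (X p w) < t)%R] <= t%:E)%E.

(** 5000 is 8 * 625; codes that are not valid trees contribute the empty event. *)
Lemma probability_large_component :
  (P [set w | ~~ (max_component_size (Q w) <= 4)%N] <=
   5000%:E * ((n.+1%:R ^+ 5)%:E * 'E_P[fun w => (F (diag_min (Q w)) ^+ 4)%R]))%E.
Proof.
pose J := ({ffun 'I_5 -> 'I_n.+1} * {ffun 'I_4 -> 'I_5})%type.
pose below (j : J) := if valid_tree j.1 j.2 then
  [set w | forall p, p \in tree_edges j.1 j.2 -> X p w < diag_min (Q w)] else set0.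
have E0 : (0 <= 'E_P[fun w => (F (diag_min (Q w)) ^+ 4)%R])%E.
  by apply: expectation_ge0 => w; rewrite exprn_even_ge0.
have mb j : measurable (below j).
  rewrite /below; case: ifP => _; last exact: measurable0.
  rewrite (_ : [set w | _] = \bigcap_(p in [set` tree_edges j.1 j.2])
      [set w | X p w < diag_min (Q w)]); last by [].
  apply: fin_bigcap_measurable => // p _; apply: measurable_lt_set; first exact: mQ.
  exact: measurable_diag_min.
have bE j : (P (below j) <= 8%:E * 'E_P[fun w => (F (diag_min (Q w)) ^+ 4)%R])%E.
  rewrite /below; case: ifP => vj; last by rewrite measure0 mule_ge0.
  apply: probability_below => //; first exact: tree_edges_offdiag.
  exact: card_tree_edges.
apply: (@le_trans _ _ (P (\bigcup_j below j))).
  apply: le_measure; rewrite ?inE.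
  - by rewrite (_ : [set w | _] = ~` [set w | (max_component_size (Q w) <= 4)%N]);
      [apply: measurableC; exact: measurable_max_component_size|
       apply/seteqP; split=> w /= /negP].
  - by apply: fin_bigcup_measurable => [|j _]; [exact: finite_finset|exact: mb].
  - move=> w /= /(large_component_tree (symQ w))[v [p [vp h]]].
    by exists (v, p) => //; rewrite /below /= vp.
apply: le_trans (measure_fin_bigcup_le _ mb) _.
apply: (@le_trans _ _ (\sum_(j : J) 8%:E * 'E_P[fun w => (F (diag_min (Q w)) ^+ 4)%R])%E).
  by apply: lee_sum => j _; exact: bE.
set c := ('E_P[_])%E in E0 *; rewrite (eq_bigr (fun=> 1%:E * (8%:E * c))%E) => [|j _]; last first.
  by rewrite mul1e.
rewrite -ge0_sume_distrl// sumEFin sumr_const card_prod !card_ffun !card_ord.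
rewrite !muleA -!EFinM (_ : 5000 * n.+1%:R ^+ 5 = (n.+1 ^ 5 * 5 ^ 4)%:R * 8)//.
by rewrite natrM !natrX; ring.
Qed.

End LargeComponentBound.

(** * Coincidences of candidate values *)

Section CandidateEquation.
Variable R : realType.

(** If the minor without [a] were singular, a padded kernel vector u would satisfy u' N u = 0 and
    u_a = 0. Removing its multiple of [x] gives sum zero and form zero, so u is a multiple of [x];
    as [x a 0] is nonzero, u = 0. *)
Lemma psd_ker_cofactor n (N : 'M[R]_n) (x : 'cV[R]_n) a : N^T = N ->
  N *m x = 0 -> vecsum x = 1 -> x a 0 != 0 ->
  (forall u : 'cV[R]_n, u != 0 -> vecsum u = 0 -> 0 < quadform N u) ->
  \det N = 0 /\ cofactor N a a != 0.
Proof.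
move=> sN Nx x1 xa pd; split.
  apply/eqP/det0P; exists x^T.
    by rewrite trmx_eq0; apply: contra_neq xa => ->; rewrite mxE.
  by apply: trmx_inj; rewrite trmx_mul trmxK sN Nx trmx0.
rewrite /cofactor mulf_eq0 signr_eq0 /=; apply/det0P => -[v v0 vN].
pose u : 'cV[R]_n := \col_j if unlift a j is Some k then v 0 k else 0.
have uE k : u (lift a k) 0 = v 0 k by rewrite mxE liftK.
have ua : u a 0 = 0 by rewrite mxE unlift_none.
have qu : quadform N u = 0.
  rewrite quadform_bil bilE (bigD1_ord a)//= ua mul0r add0r big1// => k _.
  rewrite [X in _ * X]mxE (bigD1_ord a)//= ua mulr0 add0r.
  rewrite (_ : \sum_i _ = (v *m row' a (col' a N)) 0 k); first by rewrite vN [X in _ * X]mxE mulr0.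
  rewrite mxE; apply: eq_bigr => l _; rewrite uE [RHS]mulrC !mxE; congr (_ * _).
  by rewrite -[in LHS]sN mxE.
pose u0 := u - vecsum u *: x.
have su0 : vecsum u0 = 0.
  by rewrite /u0 -scaleN1r vecsumD !vecsumZ x1 mulr1 mulN1r subrr.
have Nu0 : quadform N u0 = 0.
  have xN y : bil N y x = 0 by rewrite /bil -mulmxA Nx mulmx0 mxE.
  rewrite /u0 -scaleNr quadformD// bilZl (bilC _ _ sN) xN mulr0 mulr0 addr0 qu add0r.
  by rewrite quadformZ quadform_bil xN mulr0.
have u0E : u = vecsum u *: x.
  apply/eqP; rewrite -subr_eq0; apply/negPn/negP => u00.
  by have := pd _ u00 su0; rewrite -/u0 Nu0 ltxx.
have su : vecsum u = 0.
  apply/eqP; have := ua; rewrite u0E mxE => /eqP; rewrite mulf_eq0 (negbTE xa) orbF.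
  by rewrite vecsumZ x1 mulr1.
move/eqP: v0; apply; apply/matrixP => i k; rewrite (ord1 i) -uE u0E su !mxE mul0r//.
Qed.

Variable n : nat.
Variable Q : 'M[R]_n.+1.
Hypothesis symQ : Q^T = Q.

Lemma candidateP (T : {set 'I_n.+1}) l : candidate Q T l ->
  [/\ (0 < #|T|)%N, kkt_matrix Q T \in unitmx,
      exists x : 'cV[R]_#|T|,
        [/\ principal Q T *m x = l *: ones #|T| 1, vecsum x = 1 &
            forall i, 0 < x i 0] &
      forall u : 'cV[R]_#|T|, u != 0 -> vecsum u = 0 ->
        0 < quadform (principal Q T) u].
Proof.
case=> [[i TE lE]|[T2 kT xT pT]]; last by split=> //; exact: ltnW.
have iT j : j \in T -> j = i by rewrite TE inE => /eqP.
have T0 : (0 < #|T|)%N by rewrite TE cards1.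
have eqT (a b : 'I_#|T|) : a = b.
  by apply: enum_val_inj; rewrite (iT _ (enum_valP a)) (iT _ (enum_valP b)).
have sumT (f : 'I_#|T| -> R) a : \sum_b f b = f a.
  by rewrite (bigD1 a)//= big1 ?addr0// => b; rewrite (eqT b a) eqxx.
have pd (u : 'cV[R]_#|T|) : u != 0 -> vecsum u = 0 -> 0 < quadform (principal Q T) u.
  move=> u0; rewrite vecsumE => su; move/eqP: u0; case; apply/matrixP => a b.
  by rewrite (ord1 b) mxE -[LHS](sumT (fun a => u a 0)).
split=> //; first exact: kkt_matrix_unit.
exists (const_mx 1); split=> [||a]; last by rewrite mxE.
  apply/matrixP => a b; rewrite !mxE (sumT _ a) !mxE lE !mulr1.
  by rewrite (iT _ (enum_valP a)).
by rewrite vecsumE (sumT _ (Ordinal T0)) mxE.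
Qed.

(** Cramer's rule for the last unknown of the KKT system with right-hand side (0, 1). As a total
    function of the entries in [T] it is measurable without reference to admissibility. *)
Definition kkt_value (T : {set 'I_n.+1}) : R :=
  (\det (kkt_matrix Q T))^-1 *
  cofactor (kkt_matrix Q T) (rshift #|T| 0) (rshift #|T| 0).

Lemma candidate_kkt_value (T : {set 'I_n.+1}) l : candidate Q T l -> l = kkt_value T.
Proof.
move=> /candidateP[_ kT [x [Ex x1 _]] _].
pose y : 'cV[R]_(#|T| + 1) := col_mx x (const_mx l).
have Ky : kkt_matrix Q T *m y = col_mx 0 (const_mx 1).
  rewrite mul_block_col mul0mx addr0 Ex; congr col_mx.
    by apply/matrixP => a b; rewrite !mxE big_ord1 !mxE mulr1 mulN1r subrr.
  by apply/matrixP => a b; rewrite !ord1 [RHS]mxE -x1.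
have -> : l = y (rshift #|T| 0) 0 by rewrite col_mxEd mxE.
rewrite -[y](mulKmx kT) Ky mxE big_split_ord /= big1 ?add0r => [|a _]; last first.
  by rewrite col_mxEu mxE mulr0.
rewrite big_ord1 col_mxEd [const_mx _ _ _]mxE mulr1.
by rewrite /invmx kT !mxE.
Qed.

(* [det (Q[T] - l E)] vanishes and is affine in the entry Q i i, with nonzero
   slope; this determines Q i i from the other entries and l. *)
Lemma candidate_diag (T : {set 'I_n.+1}) l i (iT : i \in T) : candidate Q T l ->
  let N := principal Q T - l *: ones #|T| #|T| in
  let a := enum_rank_in iT i in
  Q i i = l - (\sum_(j | j != a) N a j * cofactor N a j) / cofactor N a a.
Proof.
move=> /candidateP[_ _ [x [Ex x1 x0]] pd] N a.
have sN : N^T = N.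
  apply/matrixP => b c; rewrite !mxE; congr (_ - _).
  by rewrite -[in LHS]symQ mxE.
have onesx (u : 'cV[R]_#|T|) : ones #|T| #|T| *m u = vecsum u *: ones #|T| 1.
  apply/matrixP => b c; rewrite (ord1 c) !mxE mulr1 vecsumE.
  by apply: eq_bigr => ? _; rewrite mxE mul1r.
have Nx : N *m x = 0.
  by rewrite mulmxBl Ex -scalemxAl onesx x1 scale1r subrr.
have pdN (u : 'cV[R]_#|T|) : u != 0 -> vecsum u = 0 -> 0 < quadform N u.
  move=> u0 su; rewrite /quadform -mulmxA mulmxBl -scalemxAl onesx su scale0r scaler0.
  by rewrite subr0 mulmxA; exact: pd.
have [] := psd_ker_cofactor (a := a) sN Nx x1 (lt0r_neq0 (x0 a)) pdN.
rewrite (expand_det_row _ a) (bigD1 a)//= => /eqP; rewrite addr_eq0 => /eqP E c0.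
have Naa : N a a = Q i i - l by rewrite !mxE mulr1 enum_rankK_in.
by rewrite -[X in _ - X / _]opprK -E Naa mulNr mulfK// opprK addrC subrK.
Qed.

End CandidateEquation.

Section MatrixMeasurability.
Context d (T : measurableType d) (R : realType).

Lemma measurable_inv (f : T -> R) : measurable_fun setT f ->
  measurable_fun setT (fun w => (f w)^-1).
Proof.
(* Squaring makes the base nonnegative, where the power -1 is the inverse; at a zero of [f] both
   sides are 0. *)
move=> mf; rewrite (_ : (fun w => _) = fun w => f w * ((f w ^+ 2) `^ (-1))).
  apply: measurable_funM => //.
  exact: (measurableT_comp (@measurable_powR R (-1)) (measurable_funX 2 mf)).
apply/funext => w; rewrite powR_inv1 ?sqr_ge0//.
have [->|f0] := eqVneq (f w) 0; first by rewrite invr0 mul0r.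
by rewrite expr2 invfM mulrA mulfV// mul1r.
Qed.

Lemma measurable_det n (A : T -> 'M[R]_n) :
  (forall i j, measurable_fun setT (fun w => A w i j)) ->
  measurable_fun setT (fun w => \det (A w)).
Proof.
move=> mA; rewrite /determinant; apply: measurable_sum => s.
apply: measurable_funM; first exact: measurable_cst.
by apply: measurable_prod.
Qed.

(** Row [i] is deleted in the cofactor. This is how cofactors along the row of Q_ii are seen to be
    independent of Q_ii. *)
Lemma measurable_cofactor n (A : T -> 'M[R]_n) i j :
  (forall k l, k != i -> measurable_fun setT (fun w => A w k l)) ->
  measurable_fun setT (fun w => cofactor (A w) i j).
Proof.
move=> mA; apply: measurable_funM; first exact: measurable_cst.
apply: measurable_det => k l; under eq_fun do rewrite !mxE.
by apply: mA; rewrite eq_sym neq_lift.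
Qed.

Lemma measurable_kkt_value n (Q : T -> 'M[R]_n.+1) (S : {set 'I_n.+1}) :
  (forall i j, i \in S -> j \in S -> measurable_fun setT (fun w => Q w i j)) ->
  measurable_fun setT (fun w => kkt_value (Q w) S).
Proof.
move=> mQ.
have mK k l : measurable_fun setT (fun w => kkt_matrix (Q w) S k l).
  rewrite -[k]splitK -[l]splitK; case: (fintype.split k) => k'; case: (fintype.split l) => l'.
  - under eq_fun do rewrite /unsplit /= block_mxEul mxE.
    by apply: mQ; exact: enum_valP.
  - by under eq_fun do rewrite /unsplit /= block_mxEur; exact: measurable_cst.
  - by under eq_fun do rewrite /unsplit /= block_mxEdl; exact: measurable_cst.
  - by under eq_fun do rewrite /unsplit /= block_mxEdr; exact: measurable_cst.
apply: measurable_funM; last by apply: measurable_cofactor.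
by apply: measurable_inv; exact: measurable_det.
Qed.

End MatrixMeasurability.

(** * Independence of one entry from all the others *)

Section IndependentCoordinate.
Context d (T : measurableType d) (R : realType) (P : probability T R).
Variables (I : finType) (X : I -> T -> R) (i : I).
Hypothesis mX : forall p, measurable_fun setT (X p).
Hypothesis indep : mutually_independent P X.

(** A pi-system generating the sigma-algebra of all coordinates except [X i]. *)
Definition other_cylinders : set (set T) :=
  [set E | exists B : I -> set R, (forall p, measurable (B p)) /\
     E = \bigcap_(p in [set` [set~ i]%SET]) X p @^-1` B p].

Let mpre p B : measurable B -> measurable (X p @^-1` B).
Proof. by move=> mB; rewrite -[X in measurable X]setTI; exact: mX. Qed.

Lemma other_cylinders_measurable : other_cylinders `<=` measurable.
Proof.
by move=> E [B [mB ->]]; apply: fin_bigcap_measurable => // p _; exact: mpre.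
Qed.

(** Both sides are finite measures in [E] that agree on the cylinders, hence on the sigma-algebra
    they generate. *)
Lemma independent_coordinate (A : set R) (E : set T) : measurable A ->
  <<s other_cylinders >> E -> P (X i @^-1` A `&` E) = (P (X i @^-1` A) * P E)%E.
Proof.
move=> mA; have mXA := mpre i mA.
have PA0 : 0 <= fine (P (X i @^-1` A)) by rewrite fine_ge0.
pose m1 : {measure set T -> \bar R} := mrestr P mXA.
pose m2 : {measure set T -> \bar R} := mscale (NngNum PA0) P.
have PAE : (fine (P (X i @^-1` A)))%:E = P (X i @^-1` A).
  by rewrite fineK// fin_num_measure.
have m1E F : m1 F = P (X i @^-1` A `&` F) by rewrite setIC.
have m2E F : m2 F = (P (X i @^-1` A) * P F)%E by rewrite -PAE.
suff H : forall E, <<s other_cylinders >> E -> m1 E = m2 E.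
  by move=> /H; rewrite m1E m2E.
apply: (@g_sigma_algebra_measure_unique _ _ _ other_cylinders _ (fun=> setT)).
- exact: other_cylinders_measurable.
- move=> _; exists (fun=> setT); split=> //.
  by apply/seteqP; split.
- by apply/seteqP; split=> // w _; exists 0%N.
- move=> _ _ [B [mB ->]] [C [mC ->]]; exists (fun p => B p `&` C p); split.
    by move=> p; exact: measurableI.
  apply/seteqP; split=> w /=.
    by move=> [h1 h2] p pi; split; [exact: h1|exact: h2].
  by move=> h; split=> p /h [].
- move=> _ [B [mB ->]]; rewrite m1E m2E.
  pose D p := if p == i then A else B p.
  have -> : X i @^-1` A = \bigcap_(p in [set` [set i]%SET]) X p @^-1` D p.
    apply/seteqP; split=> w /=.
      by move=> h p /finset.set1P ->; rewrite /D eqxx.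
    by move=> h; have := h i (set11 i); rewrite /D eqxx.
  have -> : \bigcap_(p in [set` [set~ i]%SET]) X p @^-1` B p =
            \bigcap_(p in [set` [set~ i]%SET]) X p @^-1` D p.
    by apply: eq_bigcapr => p /=; rewrite !inE /D => /negbTE ->.
  apply: independent_disjoint => //.
    by rewrite disjoint_subset; apply/fintype.subsetP => p; rewrite !inE negbK.
  by move=> p; rewrite /D; case: eqP.
- by move=> _; rewrite /m1 /= /mrestr -ge0_fin_numE// fin_num_measure// setTI.
Qed.

(* The joint law of (g, X i) is a product, and the diagonal is negligible for a
   product with an atomless factor. *)
Lemma probability_eq_other0 (g : T -> R) :
  (forall x, P (X i @^-1` [set x]) = 0) ->
  measurable_fun (setT : set (g_sigma_algebraType other_cylinders)) g ->
  measurable [set w | X i w = g w] /\ P [set w | X i w = g w] = 0%E.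
Proof.
move=> atomless mg'.
have mg : measurable_fun (setT : set T) g.
  move=> _ B mB; have := mg' measurableT B mB.
  apply: (smallest_sub (@sigma_algebra_measurable _ T)).
  exact: other_cylinders_measurable.
have mXi := mX i.
pose X' : {mfun T >-> R} := mfun_Sub (mem_set mXi).
pose g' : {mfun T >-> R} := mfun_Sub (mem_set mg).
have mgX : measurable_fun setT (fun w => (g w, X i w)).
  by apply: measurable_fun_pair.
pose gX : {mfun T >-> (R * R)%type} := mfun_Sub (mem_set mgX).
pose D := [set xy : R * R | xy.1 = xy.2].
have mD : measurable D.
  have := measurable_fun_eqr (@measurable_fst _ _ R R) (@measurable_snd _ _ R R).
  move=> /(_ measurableT [set true] Logic.I); rewrite setTI; congr measurable.
  by apply/seteqP; split=> xy /= /eqP.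
have -> : [set w | X i w = g w] = gX @^-1` D by apply/seteqP; split=> w /=.
split; first by rewrite -[X in measurable X]setTI; apply: (mgX).
have prod (A B : set R) : measurable A -> measurable B ->
    distribution P gX (A `*` B) = (distribution P g' A * distribution P X' B)%E.
  move=> mA mB; rewrite /distribution /pushforward /=.
  have -> : (fun w => (g w, X i w)) @^-1` (A `*` B) = X i @^-1` B `&` g @^-1` A.
    by apply/seteqP; split=> w /= [].
  have sA : <<s other_cylinders >> (g @^-1` A).
    by have := mg' measurableT A mA; rewrite setTI.
  by rewrite muleC; exact: (independent_coordinate mB sA).
have joint := product_measure_unique prod mD.
transitivity (distribution P gX D) => //; rewrite -joint.
rewrite /product_measure1 /=; apply: integral0_eq => x _ /=.
rewrite (_ : xsection D x = [set x]); first exact: atomless.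
by apply/seteqP; split=> y; rewrite /xsection /= inE /D /= => ->.
Qed.

End IndependentCoordinate.

Section DistinctCandidates.
Context d (T : measurableType d) (R : realType) (P : probability T R) (n : nat).
Variables (Q : T -> 'M[R]_n.+1).
Hypothesis symQ : forall w, (Q w)^T = Q w.
Hypothesis mQ : forall i j, measurable_fun setT (fun w => Q w i j).
Let X (p : upper_index n) (w : T) : R := Q w (val p).1 (val p).2.
Hypothesis indep : mutually_independent P X.
Hypothesis atomless : forall i x, P [set w | Q w i i = x] = 0%E.

Definition same_candidate (T1 T2 : {set 'I_n.+1}) : set T :=
  [set w | exists2 l, candidate (Q w) T1 l & candidate (Q w) T2 l].

Lemma same_candidate_negligible (T1 T2 : {set 'I_n.+1}) i : i \in T1 -> i \notin T2 ->
  P.-negligible (same_candidate T1 T2).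
Proof.
move=> iT1 iT2; pose pi := edge_index i i.
have Xpi w : X pi w = Q w i i by rewrite /X val_edge_index leqnn.
have mX p : measurable_fun setT (X p) by exact: mQ.
have mother j k : (j != i) || (k != i) ->
    measurable_fun (setT : set (g_sigma_algebraType (other_cylinders X pi)))
      (fun w => Q w j k).
  move=> jk _ B mB; rewrite setTI; apply: sub_sigma_algebra.
  pose p := edge_index j k.
  have QX : (fun w => Q w j k) = X p.
    apply/funext => w; rewrite /X val_edge_index; case: ifP => _ //=.
    by rewrite -{1}symQ mxE.
  have pni : p != pi.
    apply: contraTN jk => /eqP/(congr1 val); rewrite !val_edge_index leqnn negb_or !negbK.
    by case: ifP => _ [-> ->]; rewrite eqxx.
  exists (fun q => if q == p then B else setT); split; first by move=> q; case: ifP.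
  rewrite QX; apply/seteqP; split=> w /=.
    by move=> h q _ /=; case: eqP => // ->.
  by move=> h; have := h p; rewrite /= !inE eqxx; exact.
pose a := enum_rank_in iT1 i.
pose l w := kkt_value (Q w) T2.
pose N w := principal (Q w) T1 - l w *: ones #|T1| #|T1|.
(* The right-hand side of [candidate_diag], with the common value computed from [T2]. It avoids
   Q_ii: [i] is not in [T2], the sum omits the diagonal term, and the cofactors omit row [a]. *)
pose g w := l w - (\sum_(j | j != a) N w a j * cofactor (N w) a j) / cofactor (N w) a a.
have ml : measurable_fun (setT : set (g_sigma_algebraType (other_cylinders X pi))) l.
  apply: measurable_kkt_value => j k jT _; apply: mother; apply/orP; left.
  by apply: contraNneq iT2 => <-.
have ne b : b != a -> enum_val b != i.
  by apply: contra_neq => E; apply: enum_val_inj; rewrite E /a enum_rankK_in.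
have mN b c : (b != a) || (c != a) ->
    measurable_fun (setT : set (g_sigma_algebraType (other_cylinders X pi)))
      (fun w => N w b c).
  move=> bc; have -> : (fun w => N w b c) =
      fun w => Q w (enum_val b) (enum_val c) - l w.
    by apply/funext => w; rewrite !mxE mulr1.
  apply: measurable_funB => //; apply: mother.
  by case/orP: bc => /ne ->; rewrite ?orbT.
have mcof j : measurable_fun (setT : set (g_sigma_algebraType (other_cylinders X pi)))
    (fun w => cofactor (N w) a j).
  by apply: measurable_cofactor => b c ba; apply: mN; rewrite ba.
have mg : measurable_fun (setT : set (g_sigma_algebraType (other_cylinders X pi))) g.
  apply: measurable_funB => //; apply: measurable_funM; last exact: measurable_inv.
  have -> : (fun w => \sum_(j | j != a) N w a j * cofactor (N w) a j) =
      fun w => \sum_j (if j != a then fun w => N w a j * cofactor (N w) a j else cst 0) w.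
    by apply/funext => w; rewrite big_mkcond; apply: eq_bigr => j _; case: ifP.
  apply: measurable_sum => j; case: ifP => ja; last exact: measurable_cst.
  by apply: measurable_funM => //; apply: mN; rewrite ja orbT.
have at0 x : P (X pi @^-1` [set x]) = 0.
  have -> : X pi @^-1` [set x] = [set w | Q w i i = x]; last exact: atomless.
  by apply/seteqP; split=> w /=; rewrite Xpi.
have [mE PE] := probability_eq_other0 mX indep at0 mg.
exists [set w | X pi w = g w]; split=> // w [c c1 c2] /=.
rewrite Xpi (candidate_diag (symQ w) iT1 c1) /g /N /l.
by rewrite -(candidate_kkt_value c2).
Qed.

Lemma ae_local_candidates_distinct : {ae P, forall w, local_candidates_distinct (Q w)}.
Proof.
pose bad (T12 : {set 'I_n.+1} * {set 'I_n.+1}) :=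
  if T12.1 == T12.2 then set0 else same_candidate T12.1 T12.2.
have nbad T12 : P.-negligible (bad T12).
  rewrite /bad; case: eqP => [_|/eqP]; first exact: negligible_set0.
  rewrite finset.eqEsubset negb_and => /orP[] /fintype.subsetPn[i i1 i2].
    exact: same_candidate_negligible i1 i2.
  apply: negligibleS (same_candidate_negligible i1 i2).
  by move=> w [l l1 l2]; exists l.
apply: (@negligibleS _ _ _ P (\bigcup_(T12 : {set 'I_n.+1} * {set 'I_n.+1}) bad T12)).
  move=> w /= nd; apply: contrapT => nb; apply: nd.
  move=> C1 C2 T1 T2 l1 l2 _ _ _ _ _ _ c1 c2 T12 l12; apply: nb.
  exists (T1, T2) => //; rewrite /bad /=; case: eqP => // _.
  by exists l1 => //; rewrite l12.
pose enumb := index_enum ({set 'I_n.+1} * {set 'I_n.+1})%type.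
rewrite (_ : setT = [set` enumb]); last first.
  by apply/seteqP; split=> // x _ /=; exact: mem_index_enum.
rewrite bigcup_seq; elim: enumb => [|b s IH]; first by rewrite big_nil; exact: negligible_set0.
by rewrite big_cons; exact: negligibleU.
Qed.

End DistinctCandidates.

(** * Assembly of the limits *)

Lemma le_measure_ae d (T : measurableType d) (R : realType)
    (mu : {measure set T -> \bar R}) (A B : set T) :
  measurable A -> measurable B -> {ae mu, forall w, A w -> B w} ->
  (mu A <= mu B)%E.
Proof.
move=> mA mB [N [mN N0 ABN]]; rewrite -[leRHS]adde0 -N0.
apply: le_trans (measureU2 _ mB mN); apply: le_measure; rewrite ?inE//.
  exact: measurableU.
move=> w Aw; have [Bw|Bw] := pselect (B w); [by left|right].
by apply: ABN => /= /(_ Aw).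
Qed.

(* The random matrix with index n has order n.+1. *)
Theorem theorem2p3 (R : realType) (d : nat -> measure_display)
    (Omega : forall n, measurableType (d n))
    (P : forall n, probability (Omega n) R)
    (X : forall n, 'I_n.+1 -> 'I_n.+1 -> {RV (P n) >-> R})
    (FD FO : R -> R)
    (Q := fun n => random_matrix (X n))
    (sym : forall n w, (Q n w)^T = Q n w)
    (A1 : forall n, mutually_independent (P n)
      (fun (p : {ij : 'I_n.+1 * 'I_n.+1 | (ij.1 <= ij.2)%N}) (w : Omega n) =>
         Q n w (val p).1 (val p).2))
    (A2_diag : forall n i (x : R), cdf (X n i i) x = (FD x)%:E)
    (A2_off : forall n (i j : 'I_n.+1) (x : R), (i < j)%N ->
      cdf (X n i j) x = (FO x)%:E)
    (A2_diag_ac : forall n i,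
      distribution (P n) (X n i i) `<< @lebesgue_measure R)
    (A2_off_ac : forall n (i j : 'I_n.+1), (i < j)%N ->
      distribution (P n) (X n i j) `<< @lebesgue_measure R)
    (A3 : (((n.+1%:R ^+ 5)%R)%:E *
           'E_(P n)[fun w => (FO (diag_min (Q n w)) ^+ 4)%R])%E
          @[n --> \oo] --> 0%E) :
  [/\ P n [set w | unique_rank_one_optimizer (Q n w)] @[n --> \oo] --> 1%E,
      P n [set w | (max_component_size (Q n w) <= 4)%N] @[n --> \oo] --> 1%E,
      forall n w, (max_component_size (Q n w) <= 4)%N ->
        dnn_value (shifted (Q n w)) =
          min_component_value (Q n w)
            (fun C => dnn_value (principal (shifted (Q n w)) C)),
      forall (r : nat) (A : 'M[R]_r), (r <= 4)%N ->
        doubly_nonneg A <-> completely_positive A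
    & [/\ forall n w, (max_component_size (Q n w) <= 4)%N ->
        forall C, C \in components (Q n w) ->
          dnn_value (principal (shifted (Q n w)) C) =
            simplex_value (principal (shifted (Q n w)) C),
      forall n, {ae P n, forall w, local_candidates_distinct (Q n w)}
    & forall n, {ae P n, forall w, (max_component_size (Q n w) <= 4)%N ->
        unique_rank_one_optimizer (Q n w)}]].
Proof.
have QE n w i j : Q n w i j = X n i j w by rewrite mxE.
have mQ n i j : measurable_fun setT (fun w => Q n w i j).
  rewrite (_ : (fun w => _) = X n i j); first exact: measurable_funPT.
  by apply/funext => w; rewrite QE.
(* Order two is the smallest with an off-diagonal entry; its law shows that [FO] is a distribution
   function, for use at every [n]. *)
have off01 : (@ord0 1 < @ord_max 1)%N by [].
have F01 := A2_off 1%N ord0 ord_max ^~ off01.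
have F_off n (p : upper_index n) (t : R) : offdiag p -> 0 <= t ->
    (P n [set w | (FO (Q n w (val p).1 (val p).2) < t)%R] <= t%:E)%E.
  move=> off t0.
  have lt12 : ((val p).1 < (val p).2)%N by rewrite ltn_neqAle (valP p) andbT; exact: off.
  have := probability_cdf_lt (X := X n (val p).1 (val p).2) (fun x => A2_off n _ _ x lt12) t0.
  by under eq_set do rewrite -QE.
have atomless n i x : P n [set w | Q n w i i = x] = 0%E.
  have /null_content_dominatesP/(_ [set x] (measurable_set1 x)) := A2_diag_ac n i.
  move=> /(_ (lebesgue_measure_set1 x)) <-; rewrite /distribution /pushforward /=.
  by congr (P n _); apply/seteqP; split=> w /=; rewrite QE.
have m4 n : measurable [set w | (max_component_size (Q n w) <= 4)%N].
  exact: measurable_max_component_size.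
have ae_distinct n := ae_local_candidates_distinct (sym n) (mQ n) (A1 n) (atomless n).
have ae_unique n : {ae P n, forall w, (max_component_size (Q n w) <= 4)%N ->
    unique_rank_one_optimizer (Q n w)}.
  apply: filterS (ae_distinct n) => w dw w4.
  exact: unique_rank_one.
have large n : (P n [set w | ~~ (max_component_size (Q n w) <= 4)%N] <=
    5000%:E * ((n.+1%:R ^+ 5)%:E * 'E_(P n)[fun w => (FO (diag_min (Q n w)) ^+ 4)%R]))%E.
  apply: probability_large_component => //.
  - exact: (cdf_homo F01).
  - exact: (cdf_bounds F01).
  - exact: (measurable_cdf_fin F01).
  - exact: F_off.
have cvg_small : P n [set w | (max_component_size (Q n w) <= 4)%N] @[n --> \oo] --> 1%E.
  have cvg0 : P n [set w | ~~ (max_component_size (Q n w) <= 4)%N] @[n --> \oo] --> 0%E.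
    apply: (squeeze_cvge (f := fun=> 0%E)); first last.
    - rewrite -[X in _ --> X](mule0 5000%:E); apply: cvgeZl; last exact: A3.
      by [].
    - exact: cvg_cst.
    - by apply: nearW => n; rewrite large measure_ge0.
  have setCE n : ~` [set w | ~~ (max_component_size (Q n w) <= 4)%N] =
      [set w | (max_component_size (Q n w) <= 4)%N].
    by apply/seteqP; split=> w /=; [move=> /negP/negPn|move=> ->].
  have -> : (fun n => P n [set w | (max_component_size (Q n w) <= 4)%N]) =
      (fun n => 1 - P n [set w | ~~ (max_component_size (Q n w) <= 4)%N])%E.
    apply/funext => n; rewrite -setCE probability_setC// -[X in measurable X]setCK setCE.
    exact: measurableC.
  rewrite -[X in _ --> X](sube0 1%E); apply: cvgeB => //.
  exact: cvg_cst.
split=> //.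
(* The event of small components is almost surely contained in the uniqueness event; measurability
   of the latter turns this into an inequality of probabilities. *)
- apply: (squeeze_cvge _ cvg_small (cvg_cst 1%E)).
  apply: nearW => n; have mU := measurable_unique_rank_one (mQ n).
  by apply/andP; split; [exact: le_measure_ae|exact: probability_le1].
- by move=> n w _; exact: dnn_value_components.
- exact: dnn_cp_le4.
split=> // n w w4 C CC; apply: dnn_value_exact.
by rewrite (components_gt0 CC) (components_le w4 CC).
Qed.
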